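(* Let $u_0\in AF[0,1]$ with $u_0(0)=a_b$, $u_0(1)=a_e$, and let $u$ be the (unique mild, almost classical) solution of $$u_t-\frac{d}{dx}\big(\mathrm{sgn}(u_x)\big)=0,\qquad u(0,t)=a_b,\quad u(1,t)=a_e,\qquad u|_{t=0}=u_0 ,$$ $x\in[0,1]$. Then there is a finite $t_{ext}>0$ such that the solution $u$ reaches a steady state at $t_{ext}$, i.e. $u(t)=u(t_{ext})$ for $t>t_{ext}$. Moreover, there is an explicit estimate for $t_{ext}$ in terms of $u_0$: $$t_{ext}\le\frac{2\,K_{ess}(u_{0,x})\,A}{\ell},$$ where $\ell=1$ is the length of $[0,1]$, $A=\max\{\Delta_M,\Delta_m,B-b\}$, $B=\max\{a_b,a_e\}$, $b=\min\{a_b,a_e\}$, $\Delta_M=\max u_0-B$, $\Delta_m=b-\min u_0$.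
   Context: ''Increasing'', ''decreasing'', ''monotone'' are in the weak sense. $\mathrm{sgn}$ is understood as a multivalued maximal monotone graph with $\mathrm{sgn}(p)=1$ for $p>0$, $-1$ for $p<0$, $\mathrm{sgn}(0)=[-1,1]$. $a_b,a_e$ are given real numbers. $BV[0,1]$ is the space of functions $f$ with $\int_0^1|Df|<\infty$ (total variation of the measure $Df$). If $u$ is absolutely continuous and $u_x\in BV[0,1]$, its Clarke differential is $\partial_xu(x)=\{\tau u_x^-(x)+(1-\tau)u_x^+(x):\tau\in[0,1]\}$, with $u_x^\pm$ the one-sided derivatives; $u_x$ is identified with $\partial_xu$. Facets. A facet $F(\xi^-,\xi^+)$ of $u$ is a closed connected piece of the graph of $u$ over $[\xi^-,\xi^+]$ on which $u$ is constant, maximal with respect to inclusion; $[\xi^-,\xi^+]$ is its parameter set. A facet $F(\zeta^-,\zeta^+)$ (possibly degenerate, $\zeta^-=\zeta^+$, in which case $u$ has a strict local extremum there) is essential if for some $\epsilon>0$ either (convex) $u$ is decreasing on $(\zeta^--\epsilon,\zeta^-)$ with $u>u(\zeta^-)$ there and $u$ is increasing on $(\zeta^+,\zeta^++\epsilon)$ with $u>u(\zeta^+)$ there, or (concave) $u$ is increasing on $(\zeta^--\epsilon,\zeta^-)$ with $u<u(\zeta^-)$ there and $u$ is decreasing on $(\zeta^+,\zeta^++\epsilon)$ with $u<u(\zeta^+)$ there. The endpoints $0,1$ do not belong to parameter sets of essential facets. For $w=\partial_xu$: $\Xi_{ess}(w)$ is the union of the parameter sets of all essential facets of $u$; $K_{ess}(w)$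 is the number of essential facets (including degenerate ones). $w\in\mathrm{J\text{-}R}[0,1]$ if $w\in BV[0,1]$ and $\Xi_{ess}(w)$ consists of finitely many components, each the parameter set of an essential facet. $AF[0,1]$: absolutely continuous functions $a:[0,1]\to\mathbb R$ with $\partial_xa\in\mathrm{J\text{-}R}[0,1]$, $a(0)=a_b$, $a(1)=a_e$. Almost classical solution: $u_t-\partial_x(\mathrm{sgn}\,\bar\circ\,u_x)=0$ with the given boundary and initial data, the time derivative existing except for at most finitely many times and the $x$ derivative except for at most finitely many exceptions. Here, for $\alpha=\partial_x\beta$, $\beta\in AF[0,1]$: outside $\Xi_{ess}(\alpha)$, $\mathrm{sgn}\,\bar\circ\,\alpha=1$ where $\beta$ is increasing and $-1$ where $\beta$ is decreasing; on a connected component $[p,q]$ of $\Xi_{ess}(\alpha)$, $\mathrm{sgn}\,\bar\circ\,\alpha(x)=\pm\big(\frac{2}{q-p}x-\frac{2p}{q-p}-1\big)$, with $+$ if $F(p,q)$ is a convex facet of $\beta$ and $-$ if it is concave. Mild sense: it is specified by an integral inclusion, which the source writes for the resolvent problem $\lambda u-\frac{d}{dx}\mathrm{sgn}(u_x)=\lambda w$ in $(0,1)$, $u=w$ at $x=0,1$: for each $x\in[0,1]$, $\int_0^x(u-w)\,dx'-\frac1\lambda\,\mathrm{sgn}\,u_x\big|_0^x\ni0$; the source gives no separate formula for the evolution problem.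
   Formalization: t_ext > 0 is claimed only if K_ess(u_{0,x}) > 0 (for monotone u_0 the bound forces t_ext ≤ 0, so t_ext ≥ 0 is claimed there); almost classical includes that sgn∘u_x is defined at every t ≥ 0, so u_0 is monotone on components outside Ξ_ess. *)

(* Defs.v *)
From HB Require Import structures.
From mathcomp Require Import all_boot all_order all_algebra.
From mathcomp Require Import finmap.
From mathcomp Require Import all_classical all_reals all_analysis.
Set Implicit Arguments.
Unset Strict Implicit.
Unset Printing Implicit Defensive.
Import Order.TTheory GRing.Theory Num.Theory.
Import numFieldNormedType.Exports.
Local Open Scope classical_set_scope.
Local Open Scope ring_scope.

(* A function on [0,1] is represented by a total f : R -> R. Every notion below
   depends on the values of f on [0,1] only. *)

Definition abs_continuous01 (R : realType) (f : R -> R) : Prop :=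
  forall e : R, 0 < e -> exists2 d : R, 0 < d &
    forall (n : nat) (a b : 'I_n -> R),
      (forall i, [/\ 0 <= a i, a i <= b i & b i <= 1]) ->
      trivIset setT (fun i => `]a i, b i[%classic) ->
      \sum_(i < n) (b i - a i) < d ->
      \sum_(i < n) `|f (b i) - f (a i)| < e.

(* u_x, as an element of L^1, has a representative of bounded variation. *)
Definition derivative_in_BV01 (R : realType) (u : R -> R) : Prop :=
  exists2 g : R -> R, bounded_variation 0 1 g &
    {ae @lebesgue_measure R, forall x : R, x \in `]0, 1[ -> is_derive x 1 u (g x)}.

Definition left_derivative (R : realType) (u : R -> R) (x l : R) : Prop :=
  (fun h : R => h^-1 * (u (x + h) - u x)) @ 0^'- --> l.

Definition right_derivative (R : realType) (u : R -> R) (x r : R) : Prop :=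
  (fun h : R => h^-1 * (u (x + h) - u x)) @ 0^'+ --> r.

(* At the endpoints of [0,1] only one of the one-sided derivatives makes sense,
   and the Clarke differential consists of that number alone. *)
Definition clarke (R : realType) (u : R -> R) (x : R) : set R :=
  [set s | [\/ x = 0 /\ right_derivative u x s,
               x = 1 /\ left_derivative u x s |
               0 < x < 1 /\ exists l r tau : R,
                 [/\ left_derivative u x l, right_derivative u x r,
                     0 <= tau <= 1 & s = tau * l + (1 - tau) * r]]].

Definition sgn_graph (R : realType) (p : R) : set R :=
  [set s | [/\ -1 <= s <= 1, (0 < p -> s = 1) & (p < 0 -> s = -1)]].

(* The multivalued composition sgn(u_x)(x). *)
Definition sgn_deriv (R : realType) (u : R -> R) (x : R) : set R :=
  \bigcup_(p in clarke u x) sgn_graph p.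

Definition constant_on (R : realType) (u : R -> R) (p q : R) : Prop :=
  {in `[p, q], forall x, u x = u p}.

Definition facet (R : realType) (u : R -> R) (p q : R) : Prop :=
  [/\ 0 <= p, p <= q, q <= 1, constant_on u p q &
      forall p' q' : R, 0 <= p' -> p' <= p -> q <= q' -> q' <= 1 ->
        constant_on u p' q' -> p' = p /\ q' = q].

Definition convex_facet (R : realType) (u : R -> R) (p q : R) : Prop :=
  facet u p q /\ exists e : R,
    [/\ 0 < e, 0 <= p - e, q + e <= 1,
        {in `]p - e, p[ &, {homo u : x y /~ x <= y}} /\
        {in `]p - e, p[, forall x, u p < u x} &
        {in `]q, q + e[ &, {homo u : x y / x <= y}} /\
        {in `]q, q + e[, forall x, u q < u x}].

Definition concave_facet (R : realType) (u : R -> R) (p q : R) : Prop :=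
  facet u p q /\ exists e : R,
    [/\ 0 < e, 0 <= p - e, q + e <= 1,
        {in `]p - e, p[ &, {homo u : x y / x <= y}} /\
        {in `]p - e, p[, forall x, u x < u p} &
        {in `]q, q + e[ &, {homo u : x y /~ x <= y}} /\
        {in `]q, q + e[, forall x, u x < u q}].

Definition essential_facets (R : realType) (u : R -> R) : set (R * R) :=
  [set pq | convex_facet u pq.1 pq.2 \/ concave_facet u pq.1 pq.2].

Definition Xi_ess (R : realType) (u : R -> R) : set R :=
  \bigcup_(pq in essential_facets u) `[pq.1, pq.2]%classic.

(* Meaningful when there are finitely many essential facets, which membership in
   AF below guarantees; fset_set is empty on infinite sets. *)
Definition K_ess (R : realType) (u : R -> R) : nat :=
  #|` fset_set (essential_facets u)|.

Definition components (R : realType) (A : set R) : set (set R) :=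
  [set connected_component A x | x in A].

(* J_R u expresses that u_x (and not u) belongs to J-R[0,1]. *)
Definition J_R (R : realType) (u : R -> R) : Prop :=
  [/\ derivative_in_BV01 u,
      finite_set (components (Xi_ess u)) &
      forall C, components (Xi_ess u) C ->
        exists2 pq, essential_facets u pq & C = `[pq.1, pq.2]%classic].

Definition AF (R : realType) (a_b a_e : R) (a : R -> R) : Prop :=
  [/\ abs_continuous01 a, J_R a, a 0 = a_b & a 1 = a_e].

(* z is the composition of sgn with u_x in the refined, single-valued sense.
   On a component of [0,1] minus Xi_ess on which u is constant both signs are
   allowed; for u in AF
   this happens only if u is constant on [0,1]. At a degenerate facet
   the formula is void and the value is left free. *)
Definition is_sgn_bar (R : realType) (u z : R -> R) : Prop :=
  [/\ forall C, components (`[0, 1]%classic `\` Xi_ess u) C ->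
        ({in C &, {homo u : x y / x <= y}} /\ {in C, forall x, z x = 1}) \/
        ({in C &, {homo u : x y /~ x <= y}} /\ {in C, forall x, z x = -1}),
      forall p q, p < q -> convex_facet u p q -> {in `[p, q], forall x,
        z x = 2 / (q - p) * x - 2 * p / (q - p) - 1} &
      forall p q, p < q -> concave_facet u p q -> {in `[p, q], forall x,
        z x = - (2 / (q - p) * x - 2 * p / (q - p) - 1)}].

(* u(t, x) is written u t x. The composition has to be defined at every time,
   the equation may fail at finitely many times and, at any other time, at
   finitely many points. *)
Definition almost_classical_solution (R : realType) (a_b a_e : R) (u0 : R -> R)
    (u : R -> R -> R) : Prop :=
  [/\ {in `[0, 1], u 0 =1 u0},
      forall t : R, 0 <= t -> AF a_b a_e (u t) &
      exists z : R -> R -> R,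
        (forall t : R, 0 <= t -> is_sgn_bar (u t) (z t)) /\
        exists2 S : set R, finite_set S &
          forall t : R, 0 < t -> ~ S t ->
            exists2 X : set R, finite_set X &
              forall x : R, 0 < x < 1 -> ~ X x ->
                exists2 d : R, is_derive t 1 (fun s => u s x) d &
                               is_derive x 1 (z t) d].

(* lambda v - (d/dx) sgn(v_x) = lambda w in (0,1), v = w at 0 and 1, in the form
   int_0^x (v - w) - (1/lambda) sgn(v_x) |_0^x contains 0; one selection omega of
   sgn(v_x) serves for all x. *)
Definition resolvent_solution (R : realType) (lambda : R) (w v : R -> R) : Prop :=
  [/\ abs_continuous01 v, derivative_in_BV01 v, v 0 = w 0, v 1 = w 1 &
      exists2 omega : R -> R,
        {in `[0, 1], forall x, sgn_deriv v x (omega x)} &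
        {in `[0, 1], forall x,
          \int[@lebesgue_measure R]_(y in `[0, x]) (v y - w y)
            - lambda^-1 * (omega x - omega 0) = 0}].

Definition L2_close (R : realType) (e : R) (f g : R -> R) : Prop :=
  (\int[@lebesgue_measure R]_(x in `[0%R, 1%R]) ((f x - g x) ^+ 2)%:E
     <= (e ^+ 2)%:E)%E.

(* Mild solution of the evolution problem in the sense of nonlinear semigroup
   theory: a continuous curve in L^2(0,1) which on every [0,T] is a uniform limit
   of implicit Euler approximations. The step from v k to v k.+1 with length h
   is the resolvent problem with lambda = 1/h and w = v k, which also carries
   the Dirichlet data from u0 along. *)
Definition mild_solution (R : realType) (u0 : R -> R) (u : R -> R -> R) : Prop :=
  [/\ {in `[0, 1], u 0 =1 u0},
      forall t e : R, 0 <= t -> 0 < e -> exists2 d : R, 0 < d &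
        forall s : R, 0 <= s -> `|s - t| < d -> L2_close e (u s) (u t) &
      forall T e : R, 0 < T -> 0 < e ->
        exists (N : nat) (tau : nat -> R) (v : nat -> R -> R),
          [/\ tau 0%N = 0, tau N = T, {in `[0, 1], v 0%N =1 u0} &
              forall k, (k < N)%N ->
                [/\ 0 < tau k.+1 - tau k <= e,
                    resolvent_solution (tau k.+1 - tau k)^-1 (v k) (v k.+1) &
                    {in `]tau k, tau k.+1], forall t, L2_close e (u t) (v k.+1)}]]].

Definition max01 (R : realType) (f : R -> R) : R := sup (f @` `[0, 1]%classic).
Definition min01 (R : realType) (f : R -> R) : R := inf (f @` `[0, 1]%classic).

Definition amplitude (R : realType) (a_b a_e : R) (u0 : R -> R) : R :=
  let B := Num.max a_b a_e in
  let b := Num.min a_b a_e in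
  let Delta_M := max01 u0 - B in
  let Delta_m := b - min01 u0 in
  Num.max Delta_M (Num.max Delta_m (B - b)).

(* Main.v *)
(** Total variation is a Lyapunov function.  For an implicit Euler step [w -> v] of
    length [h] with flux [omega] in [sgn v_x], so that [v - w = h omega'], testing with
    [omega] gives [TV v + h int omega'^2 <= TV w].  If [v] is not monotone, [omega]
    takes both values [1] and [-1], hence [int omega'^2 >= 4] and the step costs [4 h]
    of variation; once the variation is minimal, [omega] is constant and nothing moves.
    So the solution is at rest after [(TV u0 - |a_e - a_b|) / 4], and [u0], monotone
    on at most [K_ess + 1] pieces with oscillation at most [3 A], has variation at
    most [6 K_ess A] when [K_ess > 0], and [|a_e - a_b|] when [K_ess = 0]. *)
Require Import Defs.
From HB Require Import structures.
From mathcomp Require Import all_boot all_order all_algebra lra ring zify finmap.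
From mathcomp Require Import all_classical all_reals all_analysis measurable_realfun.
Import Order.TTheory GRing.Theory Num.Theory.
Import numFieldNormedType.Exports.
Set Implicit Arguments.
Unset Strict Implicit.
Unset Printing Implicit Defensive.
Local Open Scope classical_set_scope.
Local Open Scope ring_scope.

(** What passes from one Euler step to the next is uniform continuity and a bound on the variation
    along uniform grids, so testing with [omega] becomes a finite sum. The grid errors vanish
    because [omega] is Lipschitz: the integral identity says [h omega' = v - w] with [v - w]
    continuous. The link from [v] back to [omega] is pointwise and weak, since the Clarke
    differential gives only two one-sided derivatives. A monotonicity criterion in these derivatives
    turns a rise of [v] over an interval into a point of that interval where [omega = 1]. The
    constant 4 is Cauchy-Schwarz between a point with [omega = 1] and one with [omega = -1]: an
    increment 2 over a length at most 1. No variation is passed to the limit of the Euler schemes: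
    any two late times are L2-close to one and the same frozen Euler state. Finally
    [3 (K + 1) A / 4 <= 3 K A / 2 < 2 K A] when [K >= 1], which leaves strict room below the claimed
    bound. *)

Definition unif_continuous01 (R : realType) (f : R -> R) : Prop :=
  forall e : R, 0 < e -> exists2 d : R, 0 < d &
    forall x y : R, 0 <= x <= 1 -> 0 <= y <= 1 -> `|x - y| < d -> `|f x - f y| < e.

Lemma abs_continuous01_unif (R : realType) (f : R -> R) :
  abs_continuous01 f -> unif_continuous01 f.
Proof.
move=> af e e0; have [d d0 H] := af e e0; exists d => //.
have K x y : 0 <= x <= 1 -> 0 <= y <= 1 -> x <= y -> y - x < d -> `|f y - f x| < e.
  move=> hx hy xy yx.
  have := H 1%N (fun=> x) (fun=> y); rewrite !big_ord1; apply => //.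
    by move=> _; split; lra.
  by move=> i j _ _ _; rewrite !ord1.
move=> x y hx hy; have [xy|/ltW yx] := leP x y.
  by rewrite distrC (distrC (f x)) ger0_norm ?subr_ge0// => /K; exact.
by rewrite ger0_norm ?subr_ge0// => /K; exact.
Qed.

Lemma unif_continuous01_eq (R : realType) (f g : R -> R) :
  {in `[0, 1], f =1 g} -> unif_continuous01 f -> unif_continuous01 g.
Proof.
move=> fg cf e e0; have [d d0 H] := cf e e0; exists d => // x y hx hy.
by rewrite -!fg ?in_itv//; exact: H.
Qed.

Lemma unif_continuous01N (R : realType) (f : R -> R) :
  unif_continuous01 f -> unif_continuous01 (\- f).
Proof.
move=> cf e e0; have [d d0 H] := cf e e0; exists d => // x y hx hy /(H _ _ hx hy).
by rewrite /= -opprD normrN.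
Qed.

Lemma unif_continuous01D (R : realType) (f g : R -> R) :
  unif_continuous01 f -> unif_continuous01 g -> unif_continuous01 (f \+ g).
Proof.
move=> cf cg e e0; have e2 : 0 < e / 2 by lra.
have [d d0 H] := cf _ e2; have [d' d'0 H'] := cg _ e2.
exists (Num.min d d'); first by rewrite lt_min d0.
move=> x y hx hy; rewrite lt_min => /andP[/(H _ _ hx hy) h1 /(H' _ _ hx hy) h2] /=.
have -> : f x + g x - (f y + g y) = (f x - f y) + (g x - g y) by ring.
by apply: le_lt_trans (ler_normD _ _) _; lra.
Qed.

Lemma unif_continuous01_mull (R : realType) (k : R) :
  unif_continuous01 (fun x => k * x).
Proof.
move=> e e0; exists (e / (`|k| + 1)); first by rewrite divr_gt0// ltr_wpDl.
move=> x y _ _; rewrite ltr_pdivlMr ?ltr_wpDl// => h.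
rewrite -mulrBr normrM; apply: le_lt_trans h.
by rewrite mulrC ler_wpM2l// lerDl.
Qed.

(** The clamp [c] onto [0,1] is 1-Lipschitz, so [f \o c] is continuous on the whole line and agrees
    with [f] on [0,1]. This gives access to the extreme value theorem and to integrability on the
    segment. *)
Lemma unif_continuous01_within (R : realType) (f : R -> R) :
  unif_continuous01 f -> {within `[0, 1], continuous f}.
Proof.
move=> cf; pose c (x : R) := Num.max 0 (Num.min 1 x).
have c01 x : 0 <= c x <= 1.
  by rewrite /c le_max lexx ge_max ler01 ge_min lexx.
have cE x : 0 <= x <= 1 -> c x = x.
  by move=> /andP[x0 x1]; rewrite /c min_r // max_r.
have cL x y : `|c x - c y| <= `|x - y|.
  have cP z : [\/ z <= 0 /\ c z = 0, 0 <= z <= 1 /\ c z = z | 1 <= z /\ c z = 1].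
    rewrite /c; have [z1|z1] := leP 1 z.
      by constructor 3; split=> //; rewrite max_r.
    have [z0|z0] := leP 0 z; first by constructor 2; split=> //; lra.
    by constructor 1; split=> //; exact: ltW.
  have h1 := ler_norm (x - y); have h2 := ler_norm (y - x); rewrite distrC in h2.
  by rewrite ler_norml; case: (cP x) => -[? ->]; case: (cP y) => -[? ->]; lra.
apply: (@subspace_eq_continuous _ _ _ (f \o c)).
  by move=> x; rewrite inE/= in_itv/= => hx; rewrite cE.
apply: continuous_subspaceT => x; apply/cvgrPdist_lt => e e0.
have [d d0 H] := cf e e0.
near=> y; apply: H => //; apply: le_lt_trans (cL _ _) _.
near: y; exact: cvgr_dist_lt.
Unshelve. all: by end_near. Qed.

(** * Monotonicity from one-sided derivatives *)

Lemma countable_itv_oo (R : realType) (a b : R) : a < b -> ~ countable `]a, b[%classic.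
Proof.
move=> ab /countable_lebesgue_measure0; rewrite lebesgue_measure_itv/= lte_fin ab.
by move=> /eqP; rewrite -EFinD eqe subr_eq0 gt_eqF.
Qed.

(** Take for [xi] the supremum of the points of [a,b] where [g] is at most [c]; continuity excludes
    both strict inequalities at [xi]. *)
Lemma last_crossing (R : realType) (g : R -> R) (a b c : R) :
  unif_continuous01 g -> 0 <= a -> a < b -> b <= 1 -> g a < c -> c < g b ->
  exists xi, [/\ a < xi < b, g xi = c & forall x, xi < x <= b -> c < g x].
Proof.
move=> cg a0 ab b1 gac cgb; pose S := [set x | a <= x <= b /\ g x <= c].
have Sa : S a by split; [rewrite lexx ltW|exact: ltW].
have ubS : ubound S b by move=> x [/andP[]].
have hS : has_sup S by split; [exists a|exists b].
pose xi := sup S.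
have axi : a <= xi by apply: sup_upper_bound.
have xib : xi <= b by apply: ge_sup => //; exists a.
have right x : xi < x <= b -> c < g x.
  move=> /andP[h1 h2]; rewrite ltNge; apply/negP => gx.
  suff : x <= xi by rewrite leNgt h1.
  by apply: sup_upper_bound => //; split => //; lra.
have gxi : g xi = c.
  apply/eqP; rewrite eq_le; apply/andP; split; rewrite leNgt; apply/negP => h.
    have [d d0 H] := cg (g xi - c) ltac:(lra).
    have [y Sy hy] := sup_adherent d0 hS.
    have yxi : y <= xi by apply: sup_upper_bound.
    case: Sy => /andP[ay yb] gy.
    have := H xi y ltac:(lra) ltac:(lra).
    rewrite ger0_norm ?subr_ge0// => /(_ ltac:(rewrite -/xi in hy; lra)).
    by rewrite ltr_norml; lra.
  have xb : xi < b.
    by rewrite lt_neqAle xib andbT; apply/eqP => E; rewrite E in h; lra.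
  have [d d0 H] := cg (c - g xi) ltac:(lra).
  pose y := Num.min b (xi + d / 2).
  have y1 : xi < y by rewrite /y lt_min; lra.
  have y2 : y <= b by rewrite /y ge_min lexx.
  have y3 : y <= xi + d / 2 by rewrite /y ge_min lexx orbT.
  have := H y xi ltac:(lra) ltac:(lra).
  rewrite ger0_norm ?subr_ge0 ?ltW// => /(_ ltac:(lra)).
  have := right y ltac:(lra).
  by rewrite ltr_norml; lra.
exists xi; split=> //; rewrite !lt_neqAle axi xib !andbT.
by apply/andP; split; apply/eqP => E; move: gxi; [rewrite -E|rewrite E]; lra.
Qed.

(* Were [f a < f b], tilt [f] to [g x = f x - e x]. At the last point where [g] takes a
   value [c] between [g a] and [g b] the right derivative of [f] is at least [e], so
   the left one is nonpositive and [c] is also a strict minimum of [g] from the left.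
   Distinct [c] then own distinct rationals, against uncountability. *)
Lemma nonincreasing_one_sided (R : realType) (f : R -> R) (a b : R) :
  unif_continuous01 f -> 0 <= a -> a <= b -> b <= 1 ->
  (forall x, a < x < b -> exists l r,
     [/\ left_derivative f x l, right_derivative f x r & l <= 0 \/ r <= 0]) ->
  f b <= f a.
Proof.
move=> cf a0 leab b1 hd; rewrite leNgt; apply/negP => fab.
have ab : a < b.
  by rewrite lt_neqAle leab andbT; apply/eqP => E; rewrite E ltxx in fab.
(* Since [b - a <= 1], a tilt with slope half the rise still leaves [g a < g b]. *)
pose e := (f b - f a) / 2; have e0 : 0 < e by rewrite /e; lra.
pose g := f \+ (fun x => (- e) * x).
have cg : unif_continuous01 g.
  exact/unif_continuous01D/unif_continuous01_mull.
have gab : g a < g b.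
  rewrite /g/= /e -subr_gt0.
  have -> : f b + - ((f b - f a) / 2) * b - (f a + - ((f b - f a) / 2) * a)
    = (f b - f a) * (1 - (b - a) / 2) by field.
  by apply: mulr_gt0; lra.
(* The range condition stands inside the existential so that choice yields a total function [q]; out
   of range, 0 serves. *)
have key c : exists q : rat, g a < c < g b -> exists xi,
    [/\ ratr q < xi, xi < b, g xi = c, (forall x, xi < x <= b -> c < g x) &
        a < ratr q /\ forall x, ratr q <= x < xi -> c < g x].
  have [hc|nhc] := boolP (g a < c < g b); last by exists 0.
  case/andP: hc => c1 c2.
  have [xi [hxi gxi xir]] := @last_crossing _ g a b c cg ltac:(lra) ab ltac:(lra) c1 c2.
  have [l [r [dl dr lr]]] := hd xi ltac:(lra).
  have re : e <= r.
    rewrite leNgt; apply/negP => re.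
    have /cvgrPdist_lt/(_ (e - r) ltac:(lra)) := dr.
    rewrite near_withinE => /nbhs_ballP[d /= d0 /(_ (Num.min d (b - xi) / 2))] /=.
    set h := Num.min d (b - xi) / 2.
    have h0 : 0 < h by rewrite /h divr_gt0// lt_min; lra.
    have hd' : h < d.
      have : Num.min d (b - xi) <= d by rewrite ge_min lexx.
      by rewrite /h; lra.
    have hb' : h < b - xi.
      have : Num.min d (b - xi) <= b - xi by rewrite ge_min lexx orbT.
      by rewrite /h in h0 *; lra.
    rewrite /ball/= sub0r normrN gtr0_norm// => /(_ hd' h0).
    rewrite ltr_norml => /andP[]; rewrite ltrBrDr ltrBlDr => h1 _.
    have : h^-1 * (f (xi + h) - f xi) < e by lra.
    rewrite mulrC ltr_pdivrMr// => h2.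
    have := xir (xi + h) ltac:(lra); rewrite -gxi /g/=; lra.
  have l0 : l <= 0 by case: lr => //; lra.
  have /cvgrPdist_lt/(_ e e0) := dl.
  rewrite near_withinE => /nbhs_ballP[d /= d0 Hd].
  have lem : Num.max a (xi - d) < xi by rewrite gt_max; lra.
  have [q] := rat_in_itvoo lem.
  rewrite in_itv/= gt_max => /andP[/andP[aq dq] hq2].
  exists q => _; exists xi; split=> //; first lra.
  split=> // x /andP[qx xxi].
  have h0 : 0 < xi - x by lra.
  have hb1 : ball 0 d (x - xi).
    by rewrite /ball/= sub0r normrN ltr0_norm; lra.
  have := Hd (x - xi) hb1 ltac:(lra).
  rewrite ltr_norml => /andP[h1 _].
  have {}h1 : (x - xi)^-1 * (f (xi + (x - xi)) - f xi) < e by lra.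
  have E : (x - xi)^-1 = - (xi - x)^-1 by rewrite -invrN opprB.
  rewrite E mulNr -mulrN mulrC ltr_pdivrMr// (addrC xi) subrK in h1.
  by rewrite -gxi /g/=; lra.
have [q Hq] := choice key.
apply: (countable_itv_oo gab); apply/countable_injP; exists (choice.pickle \o q).
(* The last crossing [x] of the lower level [c] precedes the last crossing [x'] of [c']. With a
   common rational, [x] lies in the stretch left of [x'] where [g > c'], although [g x = c < c']. *)
have main c c' : g a < c < g b -> g a < c' < g b -> c < c' -> q c = q c' -> False.
  move=> hc hc' cc' qq.
  have [x [x1 x2 gx xr [aq xl]]] := Hq c hc.
  have [x' [x'1 x'2 gx' xr' [aq' xl']]] := Hq c' hc'.
  have : x < x'.
    rewrite ltNge; apply/negP => h.
    have [E|nE] := eqVneq x' x; first by rewrite -E in gx; lra.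
    suff : c' < g x by rewrite gx; lra.
    by apply: xr'; rewrite lt_neqAle nE h ltW.
  move=> xx'; have := xl' x; rewrite -qq => /(_ ltac:(lra)); lra.
move=> c c'; rewrite !inE/= !in_itv/= => hc hc' /(pcan_inj choice.pickleK) qq.
have [cc|cc|//] := ltgtP c c'; exfalso.
- exact: (main c c').
- exact: (main c' c).
Qed.

(** * Variation along uniform grids *)

Definition grid_variation (R : realType) (f : R -> R) (n : nat) : R :=
  \sum_(0 <= i < n) `|f (i.+1%:R / n%:R) - f (i%:R / n%:R)|.

(** For continuous [f] this amounts to total variation at most [C] on [0,1]; being an asymptotic
    bound, it absorbs errors that vanish with the mesh. *)
Definition grid_variation_le (R : realType) (f : R -> R) (C : R) : Prop :=
  forall e : R, 0 < e -> \forall n \near \oo, grid_variation f n <= C + e.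

Lemma grid01 (R : realType) (i n : nat) : (0 < n)%N -> (i <= n)%N ->
  0 <= (i%:R / n%:R : R) <= 1.
Proof.
move=> n0 iN; rewrite divr_ge0//= ler_pdivrMr ?ltr0n//.
by rewrite mul1r ler_nat.
Qed.

Lemma grid_step (R : realType) (i n : nat) : (i.+1%:R / n%:R - i%:R / n%:R : R) = n%:R^-1.
Proof. by rewrite -mulrBl -natr1 addrAC subrr add0r mul1r. Qed.

Lemma grid_variation_le_eq (R : realType) (f g : R -> R) (C : R) :
  {in `[0, 1], f =1 g} -> grid_variation_le f C -> grid_variation_le g C.
Proof.
move=> fg fC e e0; near=> n.
have n0 : (0 < n)%N by near: n; exact: nbhs_infty_gt.
suff <- : grid_variation f n = grid_variation g n by near: n; exact: fC.
rewrite /grid_variation; apply: eq_big_nat => i /andP[_ iN].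
by rewrite !fg// in_itv/= grid01// ltnW.
Unshelve. all: by end_near. Qed.

Lemma grid_variation_ge (R : realType) (f : R -> R) (C : R) :
  grid_variation_le f C -> `|f 1 - f 0| <= C.
Proof.
move=> fC; apply/ler_addgt0Pr => e e0.
have : \forall n \near \oo, (0 < n)%N /\ grid_variation f n <= C + e.
  by apply: filterI; [exact: nbhs_infty_gt|exact: fC].
move=> /filter_ex[n [n0]]; apply: le_trans; rewrite /grid_variation.
have -> : f 1 - f 0 = \sum_(0 <= i < n) (f (i.+1%:R / n%:R) - f (i%:R / n%:R)).
  rewrite (telescope_sumr (fun i => f (i%:R / n%:R)))//.
  by rewrite mul0r divff// pnatr_eq0 -lt0n.
exact: ler_norm_sum.
Qed.

Lemma grid_variation_nondecreasing (R : realType) (f : R -> R) :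
  {in `[0, 1] &, {homo f : x y / x <= y}} -> grid_variation_le f `|f 1 - f 0|.
Proof.
move=> mf e e0; near=> n.
have n0 : (0 < n)%N by near: n; exact: nbhs_infty_gt.
rewrite /grid_variation.
suff -> : \sum_(0 <= i < n) `|f (i.+1%:R / n%:R) - f (i%:R / n%:R)| = f 1 - f 0.
  by have := ler_norm (f 1 - f 0); lra.
transitivity (\sum_(0 <= i < n) (f (i.+1%:R / n%:R) - f (i%:R / n%:R))).
  apply: eq_big_nat => i /andP[_ iN]; rewrite ger0_norm// subr_ge0.
  apply: mf; rewrite ?in_itv/= ?grid01 ?(ltnW iN)//.
  by rewrite ler_pM2r ?invr_gt0 ?ltr0n// ler_nat.
rewrite (telescope_sumr (fun i => f (i%:R / n%:R)))//.
by rewrite mul0r divff// pnatr_eq0 -lt0n.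
Unshelve. all: by end_near. Qed.

Lemma grid_variationN (R : realType) (f : R -> R) (n : nat) :
  grid_variation (\- f) n = grid_variation f n.
Proof. by apply: eq_bigr => i _ /=; rewrite -opprD normrN. Qed.

Lemma grid_variation_nonincreasing (R : realType) (f : R -> R) :
  {in `[0, 1] &, {homo f : x y /~ x <= y}} -> grid_variation_le f `|f 1 - f 0|.
Proof.
move=> mf e e0.
have /grid_variation_nondecreasing/(_ e e0) : {in `[0, 1] &, {homo (\- f) : x y / x <= y}}.
  by move=> x y hx hy xy /=; rewrite lerN2 mf.
rewrite /= -opprD normrN; apply: filterS => n.
by rewrite grid_variationN.
Qed.

(** * The energy inequality for one implicit step *)

(** Cauchy-Schwarz by completing the square: sum [n d^2 - 2 c d + c^2 / n >= 0] over the increments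
    [d] from [j] to [k]. The right-hand side is the Riemann sum of the squared derivative on mesh
    [1/n]. *)
Lemma sqr_increment_le (R : realFieldType) (x : nat -> R) (n j k : nat) :
  (0 < n)%N -> (j <= k)%N -> (k <= n)%N ->
  (x k - x j) ^+ 2 <= n%:R * \sum_(0 <= i < n) (x i.+1 - x i) ^+ 2.
Proof.
move=> n0 jk kn; set c := x k - x j.
have n0R : 0 < n%:R :> R by rewrite ltr0n.
have sub : \sum_(j <= i < k) (x i.+1 - x i) ^+ 2 <= \sum_(0 <= i < n) (x i.+1 - x i) ^+ 2.
  rewrite (@big_cat_nat _ _ _ j 0 n)//=; last exact: leq_trans kn.
  rewrite (@big_cat_nat _ _ _ k j n)//=.
  by rewrite addrCA lerDl addr_ge0// sumr_ge0// => i _; rewrite sqr_ge0.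
apply: le_trans (ler_wpM2l (ltW n0R) sub); rewrite mulr_sumr.
have : \sum_(j <= i < k) (2 * c * (x i.+1 - x i) - c ^+ 2 / n%:R)
       <= \sum_(j <= i < k) n%:R * (x i.+1 - x i) ^+ 2.
  apply: ler_sum => i _; rewrite -subr_ge0.
  have -> : n%:R * (x i.+1 - x i) ^+ 2 - (2 * c * (x i.+1 - x i) - c ^+ 2 / n%:R)
    = (n%:R * (x i.+1 - x i) - c) ^+ 2 / n%:R.
    by field; rewrite gt_eqF.
  by rewrite divr_ge0 ?sqr_ge0// ltW.
apply: le_trans; rewrite sumrB -mulr_sumr telescope_sumr// -/c.
rewrite sumr_const_nat -mulr_natr.
have : c ^+ 2 / n%:R * (k - j)%:R <= c ^+ 2.
  rewrite mulrAC ler_pdivrMr// ler_wpM2l ?sqr_ge0// ler_nat.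
  exact: leq_trans (leq_subr _ _) kn.
by lra.
Qed.

(* Test [w' = v' - h omega''] with [omega], on the grid of mesh [1/n]:
   [omega v' = |v'|] up to the oscillation of [omega], and summation by parts turns
   [- h omega omega''] into [h omega'^2]. *)
Lemma grid_variation_step (R : realType) (w v omega : R -> R) (h L eta a b : R) (n : nat) :
  0 < h -> 0 <= L -> (0 < n)%N -> v 0 = w 0 -> v 1 = w 1 ->
  (forall x, 0 <= x <= 1 -> -1 <= omega x <= 1) ->
  (forall x y, 0 <= x -> x <= y -> y <= 1 -> `|omega y - omega x| <= L * (y - x)) ->
  (forall x y, 0 <= x -> x <= y -> y <= 1 -> v x < v y ->
     exists2 z, x <= z <= y & omega z = 1) ->
  (forall x y, 0 <= x -> x <= y -> y <= 1 -> v y < v x ->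
     exists2 z, x <= z <= y & omega z = -1) ->
  (forall x y, 0 <= x -> x <= y -> y <= 1 -> y - x <= n%:R^-1 ->
     `|(v y - w y) - (v x - w x)| <= eta) ->
  (forall x y, 0 <= x -> x <= y -> y <= 1 -> y - x <= n%:R^-1 ->
     `|h * (omega y - omega x) - (v x - w x) * (y - x)| <= eta * (y - x)) ->
  0 <= a -> a <= b -> b <= 1 ->
  (1 - L / n%:R) * grid_variation v n
    <= grid_variation w n - h * (omega b - omega a) ^+ 2 + 8 * h * L / n%:R + 2 * eta * L.
Proof.
move=> h0 L0 n0 v0 v1 om1 omL Hinc Hdec Hosc HI a0 ab b1.
have n0R : 0 < n%:R :> R by rewrite ltr0n.
have nV : 0 < n%:R^-1 :> R by rewrite invr_gt0.
have nn : n%:R * n%:R^-1 = 1 :> R by rewrite divff ?gt_eqF.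
pose x i : R := i%:R / n%:R.
have x01 i : (i <= n)%N -> 0 <= x i <= 1 by move=> ?; exact: grid01.
have xS i : x i.+1 - x i = n%:R^-1 by exact: grid_step.
pose o i := omega (x i); pose f i := v (x i) - w (x i).
have oS i : (i < n)%N -> `|o i.+1 - o i| <= L / n%:R.
  move=> iN; have := x01 i (ltnW iN); have := x01 i.+1 iN; have := xS i => ? ? ?.
  by rewrite /o -(xS i); apply: omL; lra.
have eta0 : 0 <= eta.
  by apply: le_trans (Hosc 0 0 _ _ _ _) => //; rewrite subrr ltW.
(* On a cell where [v] rises, [omega] equals 1 somewhere, hence is at least [1 - L / n] at the left
   node; symmetrically where [v] falls. *)
have A1 : (1 - L / n%:R) * grid_variation v n
    <= \sum_(0 <= i < n) o i * (v (x i.+1) - v (x i)).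
  rewrite /grid_variation mulr_sumr; apply: ler_sum_nat => i /andP[_ iN].
  have := x01 i (ltnW iN); have := x01 i.+1 iN; have := xS i => e1 e2 e3.
  rewrite -/(x i) -/(x i.+1).
  have close z : x i <= z <= x i.+1 -> `|omega z - o i| <= L / n%:R.
    move=> hz; apply: le_trans (omL _ _ _ _ _) _; try lra.
    by rewrite -(xS i) ler_wpM2l//; lra.
  have [lt|lt|->] := ltgtP (v (x i)) (v (x i.+1)); last by rewrite subrr normr0 !mulr0.
  - have [z hz oz] := Hinc (x i) (x i.+1) ltac:(lra) ltac:(lra) ltac:(lra) lt.
    have := close z hz; rewrite oz ler_norml => /andP[_ h1].
    by rewrite gtr0_norm ?subr_gt0//; apply: ler_wpM2r; [rewrite subr_ge0 ltW|lra].
  - have [z hz oz] := Hdec (x i) (x i.+1) ltac:(lra) ltac:(lra) ltac:(lra) lt.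
    have := close z hz; rewrite oz ler_norml => /andP[h1 _].
    rewrite ltr0_norm ?subr_lt0// -(mulrNN (o i)).
    by apply: ler_wpM2r; [rewrite oppr_ge0 subr_le0 ltW|lra].
have A2 : \sum_(0 <= i < n) o i * (w (x i.+1) - w (x i)) <= grid_variation w n.
  apply: ler_sum_nat => i /andP[_ iN]; rewrite -/(x i) -/(x i.+1).
  apply: le_trans (ler_norm _) _; rewrite normrM ler_piMl// ler_norml.
  exact/om1/x01/ltnW.
(* Summation by parts; the boundary terms vanish because [v = w] at 0 and 1. *)
have A3 : \sum_(0 <= i < n) o i * (v (x i.+1) - v (x i))
  = \sum_(0 <= i < n) o i * (w (x i.+1) - w (x i))
    - \sum_(0 <= i < n) f i.+1 * (o i.+1 - o i).
  have tel : \sum_(0 <= i < n) (o i.+1 * f i.+1 - o i * f i) = 0.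
    rewrite (telescope_sumr (fun i => o i * f i))// /f /x mul0r divff ?gt_eqF//.
    by rewrite v0 v1 !subrr !mulr0 subrr.
  apply/eqP; rewrite -sumrB -subr_eq0 -sumrB; apply/eqP.
  by rewrite -[RHS]tel; apply: eq_bigr => i _; rewrite /f; ring.
(* On one cell [h D] is [f i / n] up to [eta / n], and [f i.+1] is [f i] up to [eta]. So [f i.+1] is
   [n h D] up to [2 eta], and multiplying by [D] costs a factor [L / n]. *)
have A4 i : (i < n)%N ->
    n%:R * h * (o i.+1 - o i) ^+ 2 - 2 * eta * L / n%:R <= f i.+1 * (o i.+1 - o i).
  move=> iN; have := x01 i (ltnW iN); have := x01 i.+1 iN; have := xS i => e1 e2 e3.
  have h1 := Hosc (x i) (x i.+1) ltac:(lra) ltac:(lra) ltac:(lra) ltac:(lra).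
  have h2 := HI (x i) (x i.+1) ltac:(lra) ltac:(lra) ltac:(lra) ltac:(lra).
  have h3 := oS i iN; rewrite -/(o i) -/(o i.+1) -/(f i) -/(f i.+1) e1 in h1 h2.
  set D := o i.+1 - o i in h2 h3 *.
  have h4 : `|f i.+1 - n%:R * h * D| <= 2 * eta.
    have -> : f i.+1 - n%:R * h * D = (f i.+1 - f i) - n%:R * (h * D - f i * n%:R^-1).
      by field; rewrite gt_eqF.
    apply: le_trans (ler_normB _ _) _; rewrite normrM (gtr0_norm n0R).
    have : n%:R * `|h * D - f i / n%:R| <= n%:R * (eta / n%:R) by rewrite ler_pM2l.
    by rewrite mulrCA nn mulr1; lra.
  have : `|(f i.+1 - n%:R * h * D) * D| <= 2 * eta * (L / n%:R).
    by rewrite normrM ler_pM.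
  rewrite ler_norml mulrA => /andP[h5 _].
  have -> : n%:R * h * D ^+ 2 = n%:R * h * D * D by ring.
  by move: h5; rewrite mulrBl; lra.
have A5 : h * (n%:R * \sum_(0 <= i < n) (o i.+1 - o i) ^+ 2) - 2 * eta * L
    <= \sum_(0 <= i < n) f i.+1 * (o i.+1 - o i).
  apply: le_trans (_ : \sum_(0 <= i < n)
      (n%:R * h * (o i.+1 - o i) ^+ 2 - 2 * eta * L / n%:R) <= _).
    rewrite sumrB -mulr_sumr sumr_const_nat subn0 -(mulr_natr (2 * eta * L / n%:R)).
    by rewrite divfK ?gt_eqF// mulrA (mulrC h).
  by apply: ler_sum_nat => i /andP[_ /A4].
(* [j] and [k] index the last nodes not beyond [a] and [b]; moving there changes [omega] by at most
   [L / n]. *)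
have [j [jn aj1 aj2]] : exists j, [/\ j = Num.truncn (a * n%:R), x j <= a & a <= x j + n%:R^-1].
  have /andP[t1 t2] := truncn_itv (mulr_ge0 a0 (ltW n0R)).
  exists (Num.truncn (a * n%:R)); split=> //.
    by rewrite /x ler_pdivrMr.
  by rewrite -lerBlDl -(xS (Num.truncn (a * n%:R))) lerD2r /x ler_pdivlMr// ltW.
have [k [kn bk1 bk2]] : exists k, [/\ k = Num.truncn (b * n%:R), x k <= b & b <= x k + n%:R^-1].
  have /andP[t1 t2] := truncn_itv (mulr_ge0 (le_trans a0 ab) (ltW n0R)).
  exists (Num.truncn (b * n%:R)); split=> //.
    by rewrite /x ler_pdivrMr.
  by rewrite -lerBlDl -(xS (Num.truncn (b * n%:R))) lerD2r /x ler_pdivlMr// ltW.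
have jk : (j <= k)%N.
  by rewrite jn kn; apply: le_truncn; rewrite ler_pM2r.
have kN : (k <= n)%N.
  rewrite -(ler_nat R); move: bk1; rewrite /x ler_pdivrMr// => /le_trans; apply.
  by rewrite ler_piMl// ltW.
have := x01 j (leq_trans jk kN); have := x01 k kN => xk xj.
have oa : `|omega a - o j| <= L / n%:R.
  apply: le_trans (omL _ _ _ _ _) _; try lra.
  by rewrite ler_wpM2l//; lra.
have ob : `|omega b - o k| <= L / n%:R.
  apply: le_trans (omL _ _ _ _ _) _; try lra.
  by rewrite ler_wpM2l//; lra.
(* Difference of squares: the two increments differ by at most [2 L / n], and their sum is at most 4
   in absolute value because [omega] stays in [-1,1]. Hence the 8. *)
have A6 : (omega b - omega a) ^+ 2 - 8 * (L / n%:R) <= (o k - o j) ^+ 2.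
  have oja := om1 a ltac:(lra); have okb := om1 b ltac:(lra).
  have oj := om1 _ xj; have ok := om1 _ xk; rewrite -/(o j) -/(o k) in oj ok.
  have : `|((omega b - omega a) - (o k - o j)) * ((omega b - omega a) + (o k - o j))|
      <= (2 * (L / n%:R)) * 4.
    rewrite normrM ler_pM//; last by rewrite ler_norml; lra.
    have -> : omega b - omega a - (o k - o j) = (omega b - o k) - (omega a - o j) by ring.
    by apply: le_trans (ler_normB _ _) _; lra.
  move=> /(le_trans (ler_norm _)).
  have -> : (omega b - omega a - (o k - o j)) * (omega b - omega a + (o k - o j))
    = (omega b - omega a) ^+ 2 - (o k - o j) ^+ 2 by ring.
  by lra.
have A7 := sqr_increment_le o n0 jk kN.
have A8 : h * ((omega b - omega a) ^+ 2 - 8 * (L / n%:R))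
    <= h * (n%:R * \sum_(0 <= i < n) (o i.+1 - o i) ^+ 2).
  by rewrite ler_pM2l//; exact: le_trans A7.
have -> : 8 * h * L / n%:R = h * (8 * (L / n%:R)) by ring.
rewrite mulrBr in A8; lra.
Qed.

Lemma near_infty_natdiv_le (R : realType) (K d : R) : 0 < d ->
  \forall n \near \oo, K / n%:R <= d.
Proof.
move=> d0; near=> n.
have n0 : (0 < n)%N by near: n; exact: nbhs_infty_gt.
rewrite ler_pdivrMr ?ltr0n// mulrC -ler_pdivrMr//.
by near: n; exact: nbhs_infty_ger.
Unshelve. all: by end_near. Qed.

Lemma variation_step (R : realType) (w v omega : R -> R) (h : R) :
  0 < h -> unif_continuous01 (v \- w) -> v 0 = w 0 -> v 1 = w 1 ->
  (forall x, 0 <= x <= 1 -> -1 <= omega x <= 1) ->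
  (forall x y, 0 <= x -> x <= y -> y <= 1 -> v x < v y ->
     exists2 z, x <= z <= y & omega z = 1) ->
  (forall x y, 0 <= x -> x <= y -> y <= 1 -> v y < v x ->
     exists2 z, x <= z <= y & omega z = -1) ->
  (forall x y eta, 0 <= x -> x <= y -> y <= 1 ->
     (forall z, x <= z <= y -> `|(v z - w z) - (v x - w x)| <= eta) ->
     `|h * (omega y - omega x) - (v x - w x) * (y - x)| <= eta * (y - x)) ->
  forall a b C, 0 <= a -> a <= b -> b <= 1 -> grid_variation_le w C ->
    grid_variation_le v (C - h * (omega b - omega a) ^+ 2).
Proof.
move=> h0 cf v0 v1 om1 Hinc Hdec HI a b C a0 ab b1 wC.
have [M M0 fM] : exists2 M, 0 <= M & forall x, 0 <= x <= 1 -> `|v x - w x| <= M.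
  have cn : unif_continuous01 (fun x => `|v x - w x|).
    move=> e e0; have [d d0 H] := cf e e0; exists d => // x y hx hy hxy.
    by apply: le_lt_trans (H x y hx hy hxy); exact: ler_dist_dist.
  have [c hc cM] := EVT_max ler01 (unif_continuous01_within cn).
  by exists `|v c - w c| => // x hx; apply: cM; rewrite in_itv.
(* Over [x,y] the oscillation of [v - w] is at most [2 M] and the linear term adds [M], so
   [h |omega y - omega x| <= 3 M (y - x)]. *)
pose L := 3 * M / h; have L0 : 0 <= L by rewrite divr_ge0 ?mulr_ge0// ltW.
have omL x y : 0 <= x -> x <= y -> y <= 1 -> `|omega y - omega x| <= L * (y - x).
  move=> x0 xy y1; rewrite /L mulrAC ler_pdivlMr// mulrC -[h in leLHS]gtr0_norm// -normrM.
  have hI : `|h * (omega y - omega x) - (v x - w x) * (y - x)| <= 2 * M * (y - x).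
    apply: HI => // z hz; apply: le_trans (ler_normB _ _) _.
    by have := fM z ltac:(lra); have := fM x ltac:(lra); lra.
  have : `|(v x - w x) * (y - x)| <= M * (y - x).
    rewrite normrM (ger0_norm (_ : 0 <= y - x)) ?subr_ge0// ler_wpM2r ?subr_ge0//.
    by apply: fM; lra.
  move: hI; rewrite !ler_norml => /andP[? ?] /andP[? ?]; apply/andP; split; lra.
move=> e e0; set D := C - _.
(* Chosen for [2 eta L <= e / 8]; the [+ 1] covers [L = 0]. *)
pose eta := e / 16 / (L + 1); have eta0 : 0 < eta by rewrite !divr_gt0// ltr_wpDl.
have etaL : 2 * eta * L <= e / 8.
  have -> : 2 * eta * L = e / 8 * (L / (L + 1)) by rewrite /eta; field; rewrite gt_eqF// ltr_wpDl.
  apply: ler_piMr; first lra.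
  by rewrite ler_pdivrMr ?ltr_wpDl// mul1r lerDl.
have [d d0 Hd] := cf eta eta0.
suff S n : (0 < n)%N -> 1 / n%:R <= d / 2 -> 8 * h * L / n%:R <= e / 8 ->
    L * (`|D| + e) / n%:R <= e / 2 -> L / n%:R <= 1 / 2 ->
    grid_variation w n <= C + e / 8 -> grid_variation v n <= D + e.
  near=> n; apply: S; near: n.
  - exact: nbhs_infty_gt.
  - by apply: near_infty_natdiv_le; lra.
  - by apply: near_infty_natdiv_le; lra.
  - by apply: near_infty_natdiv_le; lra.
  - by apply: near_infty_natdiv_le; lra.
  - by apply: wC; lra.
move=> n0 n1 n2 n3 n5 n4.
rewrite mul1r in n1.
have osc x y : 0 <= x -> x <= y -> y <= 1 -> y - x <= n%:R^-1 ->
    `|(v y - w y) - (v x - w x)| <= eta.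
  move=> x0 xy y1 yx; apply/ltW/Hd; try lra.
  by rewrite ger0_norm ?subr_ge0//; lra.
have hI x y : 0 <= x -> x <= y -> y <= 1 -> y - x <= n%:R^-1 ->
     `|h * (omega y - omega x) - (v x - w x) * (y - x)| <= eta * (y - x).
  by move=> x0 xy y1 yx; apply: HI => // z /andP[xz zy]; apply: osc => //; lra.
have := @grid_variation_step _ w v omega h L eta a b n h0 L0 n0 v0 v1 om1 omL
  Hinc Hdec osc hI a0 ab b1.
move=> key; have {}key : (1 - L / n%:R) * grid_variation v n <= D + e / 2.
  by rewrite /D; lra.
(* A variation above [D + e] would stay above [D + e - q (|D| + e) >= D + e / 2] after
   multiplication by [1 - q], against [key]. *)
rewrite leNgt; apply/negP => gt.
have := ler_norm D; have : 0 <= L / n%:R by rewrite divr_ge0.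
move: n3; rewrite mulrAC; set q := L / n%:R in n5 key *; move=> n3 q0 Dn.
clear -key gt n3 q0 Dn n5.
have : (1 - q) * (D + e) < (1 - q) * grid_variation v n by rewrite ltr_pM2l//; lra.
have : q * (D + e) <= q * (`|D| + e) by rewrite ler_wpM2l//; lra.
lra.
Unshelve. all: by end_near. Qed.

(** * The resolvent problem *)

(** If both one-sided derivatives are positive, so is every convex combination of them, and the
    graph of sgn forces [s = 1]; likewise for -1. *)
Lemma sgn_deriv_one_sided (R : realType) (v : R -> R) (x s : R) :
  0 < x < 1 -> sgn_deriv v x s -> exists l r,
    [/\ left_derivative v x l, right_derivative v x r,
        s != 1 -> l <= 0 \/ r <= 0 & s != -1 -> 0 <= l \/ 0 <= r].
Proof.
move=> x01 [p [[x0 _]|[x1 _]|[_ [l [r [tau [dl dr tau01 ->]]]]]] [s1 sp sn]]; try lra.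
exists l, r; split => // ns.
- have [l0|l0] := leP l 0; [by left|right]; rewrite leNgt; apply/negP => r0.
  case/eqP: ns; apply: sp.
  have [->|tau0] := eqVneq tau 0; first by rewrite mul0r add0r subr0 mul1r.
  by apply: ltr_pwDl; [rewrite mulr_gt0// lt_neqAle eq_sym tau0; lra|rewrite mulr_ge0; lra].
- have [l0|l0] := leP 0 l; [by left|right]; rewrite leNgt; apply/negP => r0.
  case/eqP: ns; apply: sn; rewrite -oppr_gt0 opprD -!mulrN.
  have [->|tau0] := eqVneq tau 0; first by rewrite mul0r add0r subr0 mul1r oppr_gt0.
  apply: ltr_pwDl; last by rewrite mulr_ge0; lra.
  by rewrite mulr_gt0 ?oppr_gt0// lt_neqAle eq_sym tau0; lra.
Qed.

Lemma sgn_deriv_bounded (R : realType) (v : R -> R) (x s : R) :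
  sgn_deriv v x s -> -1 <= s <= 1.
Proof. by case=> p _ []. Qed.

Lemma Rintegral_oc_approx (R : realType) (f : R -> R) (x y eta : R) :
  unif_continuous01 f -> 0 <= x -> x <= y -> y <= 1 ->
  (forall z, x <= z <= y -> `|f z - f x| <= eta) ->
  `|\int[@lebesgue_measure R]_(z in `]x, y]) f z - f x * (y - x)| <= eta * (y - x).
Proof.
move=> cf x0 xy y1 H.
have fin : fine (@lebesgue_measure R `]x, y]%classic) = y - x.
  rewrite lebesgue_measure_itv/= lte_fin; case: ltP => // yx.
  by rewrite (_ : y = x) ?subrr//; apply/eqP; rewrite eq_le xy yx.
have sub : `]x, y]%classic `<=` `[0, 1]%classic.
  by move=> z; rewrite /= !in_itv/=; lra.
have int (g : R -> R) : {within `[0, 1], continuous g} ->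
    (@lebesgue_measure R).-integrable `]x, y] (EFin \o g).
  move=> cg; have := continuous_compact_integrable (@segment_compact R 0 1) cg.
  exact: integrableS.
have intf := int f (unif_continuous01_within cf).
have intc c : (@lebesgue_measure R).-integrable `]x, y] (EFin \o cst c).
  by apply: int; apply: continuous_subspaceT => z; exact: cvg_cst.
have lo : (f x - eta) * (y - x) <= \int[@lebesgue_measure R]_(z in `]x, y]) f z.
  rewrite -fin -Rintegral_cst//; apply: le_Rintegral => //; first exact: intc.
  move=> z /=; rewrite in_itv/= => hz.
  by have := H z ltac:(lra); rewrite ler_norml; lra.
have hi : \int[@lebesgue_measure R]_(z in `]x, y]) f z <= (f x + eta) * (y - x).
  rewrite -fin -Rintegral_cst//; apply: le_Rintegral => //; first exact: intc.
  move=> z /=; rewrite in_itv/= => hz.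
  by have := H z ltac:(lra); rewrite ler_norml; lra.
move: (Rintegral _ _ _) lo hi => I lo hi; clear -lo hi.
by rewrite ler_norml; lra.
Qed.

(** If [omega] misses the value 1, then [v] cannot rise; if it misses -1, [v] cannot fall; otherwise
    the energy inequality applies between two points with values 1 and -1. In the last clause [v]
    shares the boundary values of [w], so its variation cannot drop below that of [w], which forbids
    any change of [omega]. *)
Lemma resolvent_step (R : realType) (w v : R -> R) (h : R) :
  0 < h -> unif_continuous01 w -> resolvent_solution h^-1 w v ->
  [/\ unif_continuous01 v, v 0 = w 0, v 1 = w 1,
      forall C, grid_variation_le w C ->
        grid_variation_le v (C - 4 * h) \/ grid_variation_le v `|v 1 - v 0| &
      grid_variation_le w `|w 1 - w 0| -> {in `[0, 1], v =1 w}].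
Proof.
move=> h0 cw [/abs_continuous01_unif cv _ v0 v1 [omega om Hom]].
have cf : unif_continuous01 (v \- w).
  exact: (unif_continuous01D cv (unif_continuous01N cw)).
have om1 x : 0 <= x <= 1 -> -1 <= omega x <= 1.
  by move=> hx; apply: (@sgn_deriv_bounded _ v x); apply: om; rewrite in_itv.
have Hinc x y : 0 <= x -> x <= y -> y <= 1 -> v x < v y ->
     exists2 z, x <= z <= y & omega z = 1.
  move=> x0 xy y1 vxy; apply: contrapT => no.
  suff : v y <= v x by rewrite leNgt vxy.
  apply: nonincreasing_one_sided => // z hz.
  have z01 : 0 < z < 1 by lra.
  have [|l [r [dl dr lr _]]] := sgn_deriv_one_sided z01 (om z _).
    by rewrite in_itv/=; lra.
  exists l, r; split=> //; apply: lr; apply/eqP => oz; apply: no; exists z => //; lra.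
have Hdec x y : 0 <= x -> x <= y -> y <= 1 -> v y < v x ->
     exists2 z, x <= z <= y & omega z = -1.
  move=> x0 xy y1 vxy; apply: contrapT => no.
  suff : (\- v) y <= (\- v) x by rewrite /= lerN2 leNgt vxy.
  apply: nonincreasing_one_sided => //; first exact: unif_continuous01N.
  move=> z hz; have z01 : 0 < z < 1 by lra.
  have [|l [r [dl dr _ lr]]] := sgn_deriv_one_sided z01 (om z _).
    by rewrite in_itv/=; lra.
  have E : (fun d => d^-1 * ((\- v) (z + d) - (\- v) z))
    = \- (fun d => d^-1 * (v (z + d) - v z)).
    by apply/funext => d /=; rewrite -opprD mulrN.
  exists (- l), (- r); split.
  - by rewrite /left_derivative E; exact: cvgN.
  - by rewrite /right_derivative E; exact: cvgN.
  - rewrite !oppr_le0; apply: lr; apply/eqP => oz; apply: no; exists z => //; lra.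
have HI x y eta : 0 <= x -> x <= y -> y <= 1 ->
     (forall z, x <= z <= y -> `|(v z - w z) - (v x - w x)| <= eta) ->
     `|h * (omega y - omega x) - (v x - w x) * (y - x)| <= eta * (y - x).
  move=> x0 xy y1 H.
  (* Subtracting the inclusion at [x] from that at [y] cancels [omega 0]. *)
  have -> : h * (omega y - omega x) = \int[@lebesgue_measure R]_(z in `]x, y]) (v z - w z).
    rewrite -(@Rintegral_itvB _ _ (BLeft 0) (BRight y)) ?bnd_simp//; last first.
      have := continuous_compact_integrable (@segment_compact R 0 1)
        (unif_continuous01_within cf).
      by apply: integrableS => // z; rewrite /= !in_itv/=; lra.
    have := Hom x; rewrite invrK => /(_ _)/eqP; rewrite subr_eq0 in_itv/=.
    move=> /(_ ltac:(lra))/eqP ->.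
    have := Hom y; rewrite invrK => /(_ _)/eqP; rewrite subr_eq0 in_itv/=.
    by move=> /(_ ltac:(lra))/eqP ->; ring.
  exact: (Rintegral_oc_approx (f := v \- w)).
have key := variation_step h0 cf v0 v1 om1 Hinc Hdec HI.
split=> //.
- move=> C wC.
  have [[a ha oa]|no] := pselect (exists2 a, 0 <= a <= 1 & omega a = 1); last first.
    right; apply: grid_variation_nonincreasing => y x; rewrite !in_itv/= => hy hx xy.
    rewrite leNgt; apply/negP => vxy; apply: no.
    have [z hz oz] := Hinc x y ltac:(lra) ltac:(lra) ltac:(lra) vxy.
    by exists z => //; lra.
  have [[b hb ob]|no] := pselect (exists2 b, 0 <= b <= 1 & omega b = -1); last first.
    right; apply: grid_variation_nondecreasing => x y; rewrite !in_itv/= => hx hy xy.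
    rewrite leNgt; apply/negP => vxy; apply: no.
    have [z hz oz] := Hdec x y ltac:(lra) ltac:(lra) ltac:(lra) vxy.
    by exists z => //; lra.
  left; have [ab|/ltW ba] := leP a b.
    have := key a b C ltac:(lra) ab ltac:(lra) wC; rewrite oa ob.
    by have -> : h * (-1 - 1) ^+ 2 = 4 * h by ring.
  have := key b a C ltac:(lra) ba ltac:(lra) wC; rewrite oa ob.
  by have -> : h * (1 - -1) ^+ 2 = 4 * h by ring.
- move=> wm; have omc a b : 0 <= a -> a <= b -> b <= 1 -> omega b = omega a.
    move=> a0 ab b1; have := grid_variation_ge (key a b _ a0 ab b1 wm).
    rewrite v0 v1 -subr_ge0 addrAC subrr add0r oppr_ge0 pmulr_rle0//.
    move=> sq0; apply/eqP; rewrite -subr_eq0 -sqrf_eq0 eq_le sq0.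
    by rewrite sqr_ge0.
  move=> x; rewrite in_itv/= => hx.
  have [->//|x1] := eqVneq x 1.
  have {}x1 : x < 1 by rewrite lt_neqAle x1; lra.
  (* With [omega] constant, [HI] on a short interval to the right of [x] reads
     [|v x - w x| (y - x) <= eta (y - x)]. The point 1, with no room to its right, was settled by
     the boundary condition. *)
  apply/eqP; rewrite -subr_eq0 -normr_le0; apply/ler_addgt0Pr => eta eta0; rewrite add0r.
  have [d d0 Hd] := cf eta eta0.
  pose y := Num.min 1 (x + d / 2).
  have y1 : y <= 1 by rewrite /y ge_min lexx.
  have y2 : y <= x + d / 2 by rewrite /y ge_min lexx orbT.
  have xy : x < y by rewrite /y lt_min; lra.
  have : `|h * (omega y - omega x) - (v x - w x) * (y - x)| <= eta * (y - x).
    apply: HI; try lra; move=> z hz; apply/ltW/Hd; try lra.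
    by rewrite ger0_norm; lra.
  rewrite (omc x y) ?subrr ?mulr0 ?sub0r ?normrN ?normrM; try lra.
  by rewrite (gtr0_norm (_ : 0 < y - x)) ?subr_gt0// ler_pM2r ?subr_gt0.
Qed.

(** * Comparison in L2 *)

Lemma L2_close_eqr (R : realType) (e : R) (f g g' : R -> R) :
  {in `[0, 1], g =1 g'} -> L2_close e f g -> L2_close e f g'.
Proof.
move=> gg; rewrite /L2_close; apply: le_trans.
rewrite le_eqVlt; apply/orP; left; apply/eqP; apply: eq_integral => x.
by rewrite inE => hx; rewrite gg.
Qed.

Lemma L2_close_refl (R : realType) (e : R) (f : R -> R) : L2_close e f f.
Proof.
rewrite /L2_close integral0_eq ?lee_fin ?sqr_ge0// => x _.
by rewrite subrr expr0n.
Qed.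

(** If [f] and [g] differ at a point, they stay apart on an interval, and there
    [(f - v)^2 + (g - v)^2 >= (f - g)^2 / 2] bounds the two errors from below, whatever [v] is. So
    [v] may depend on [e]. *)
Lemma L2_close_eq (R : realType) (f g : R -> R) :
  unif_continuous01 f -> unif_continuous01 g ->
  (forall e, 0 < e -> exists v,
     [/\ unif_continuous01 v, L2_close e f v & L2_close e g v]) ->
  {in `[0, 1], f =1 g}.
Proof.
move=> cf cg H x; rewrite in_itv/= => hx; apply/eqP/negP => /negP fgx.
set m := `|f x - g x|; have m0 : 0 < m by rewrite normr_gt0 subr_eq0.
have m2 : 0 < m / 2 by lra.
have cfg := unif_continuous01D cf (unif_continuous01N cg).
have [d d0 Hd] := cfg _ m2.
pose p := Num.max 0 (x - d / 2); pose q := Num.min 1 (x + d / 2).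
have p0 : 0 <= p by rewrite /p le_max lexx.
have p1 : x - d / 2 <= p by rewrite /p le_max lexx orbT.
have q1 : q <= 1 by rewrite /q ge_min lexx.
have q2 : q <= x + d / 2 by rewrite /q ge_min lexx orbT.
have pq : p < q by rewrite /p /q lt_min !gt_max; lra.
(* On [p,q] the gap [|f - g|] is at least [m / 2], so the two squared errors together integrate to
   at least [kap], while [2 e^2 <= kap / 2]. *)
pose kap := m ^+ 2 / 8 * (q - p).
have kap0 : 0 < kap by rewrite /kap mulr_gt0 ?divr_gt0 ?exprn_gt0 ?subr_gt0.
pose e := Num.min 1 (kap / 4).
have e0 : 0 < e by rewrite /e lt_min; lra.
have e1 : e <= 1 by rewrite /e ge_min lexx.
have e2 : e <= kap / 4 by rewrite /e ge_min lexx orbT.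
have [v [cv fv gv]] := H e e0.
have sqr_meas (k : R -> R) : unif_continuous01 k ->
    measurable_fun (`[0, 1]%classic : set (measurableTypeR R)) (fun y => ((k y - v y) ^+ 2)%:E).
  move=> ck.
  have ckv := unif_continuous01_within (unif_continuous01D ck (unif_continuous01N cv)).
  have /measurable_int/measurable_EFinP mkv :=
    continuous_compact_integrable (@segment_compact R 0 1) ckv.
  by apply/measurable_EFinP; exact: measurable_funX.
have := leeD fv gv; rewrite -ge0_integralD//; last 4 first.
- by move=> y _; rewrite lee_fin sqr_ge0.
- exact: sqr_meas.
- by move=> y _; rewrite lee_fin sqr_ge0.
- exact: sqr_meas.
apply/negP; rewrite -ltNge -EFinD.
have sub : `[p, q]%classic `<=` `[0, 1]%classic.
  by move=> y; rewrite /= !in_itv/=; lra.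
have mD := emeasurable_funD (sqr_meas f cf) (sqr_meas g cg).
apply: (@lt_le_trans _ _ (\int[@lebesgue_measure R]_(y in `[p, q])
    (((f y - v y) ^+ 2)%:E + ((g y - v y) ^+ 2)%:E))%E); last first.
  apply: ge0_subset_integral => //.
  by move=> y _; rewrite -EFinD lee_fin addr_ge0// sqr_ge0.
apply: (@lt_le_trans _ _ (\int[@lebesgue_measure R]_(y in `[p, q]) (cst (m ^+ 2 / 8)%:E y))%E).
  rewrite integral_cst//= lebesgue_measure_itv/= lte_fin pq -EFinB -EFinM lte_fin -/kap.
  have : e ^+ 2 <= e by rewrite expr2 ler_piMr// ltW.
  lra.
apply: ge0_le_integral => //.
- by move=> y _; rewrite lee_fin divr_ge0// sqr_ge0.
- exact: measurable_funS mD.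
move=> y; rewrite /= in_itv/= => hy; rewrite lee_fin.
have hyx : `|y - x| < d by rewrite ltr_norml; lra.
have := Hd y x ltac:(lra) hx hyx; rewrite /= -/(f y - g y) -/(f x - g x) => near.
have far : m / 2 <= `|f y - g y|.
  have := lerB_dist (f x - g x) (f y - g y); rewrite distrC -/m; lra.
have : (m / 2) ^+ 2 <= `|f y - g y| ^+ 2 by rewrite lerXn2r ?nnegrE//; lra.
rewrite real_normK ?num_real// => sq.
have : 0 <= (f y - v y + (g y - v y)) ^+ 2 by exact: sqr_ge0.
have E : (f y - g y) ^+ 2 = 2 * ((f y - v y) ^+ 2 + (g y - v y) ^+ 2)
   - (f y - v y + (g y - v y)) ^+ 2 by ring.
rewrite E in sq; have -> : m ^+ 2 / 8 = (m / 2) ^+ 2 / 2 by field.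
clear -sq; lra.
Qed.

(** * Euler chains and their mild limits *)

Definition euler_chain (R : realType) (u0 : R -> R) (N : nat) (tau : nat -> R)
    (v : nat -> R -> R) : Prop :=
  [/\ tau 0%N = 0, {in `[0, 1], v 0%N =1 u0} &
      forall k, (k < N)%N -> 0 < tau k.+1 - tau k /\
        resolvent_solution (tau k.+1 - tau k)^-1 (v k) (v k.+1)].

(** All states share the boundary values of [u0], hence the same least variation [|u0 1 - u0 0|]. A
    state of least variation is fixed by the next step, so the first alternative persists; before
    that, a step of length [h] lowers the bound by [4 h] or reaches the least variation. *)
Lemma euler_chain_variation (R : realType) (u0 : R -> R) (N : nat) (tau : nat -> R)
    (v : nat -> R -> R) (V : R) :
  unif_continuous01 u0 -> grid_variation_le u0 V -> euler_chain u0 N tau v ->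
  forall k, (k <= N)%N ->
    [/\ unif_continuous01 (v k), v k 0 = u0 0, v k 1 = u0 1 &
        grid_variation_le (v k) `|u0 1 - u0 0| \/ grid_variation_le (v k) (V - 4 * tau k)].
Proof.
move=> cu uV [tau0 vu Hk]; elim=> [_|k IH kN].
  have uv : {in `[0, 1], u0 =1 v 0%N} by move=> x hx; rewrite vu.
  split.
  - exact: unif_continuous01_eq cu.
  - by rewrite vu// in_itv/= lexx ler01.
  - by rewrite vu// in_itv/= lexx ler01.
  - by right; rewrite tau0 mulr0 subr0; exact: grid_variation_le_eq uV.
have [ck k0 k1 Hv] := IH (ltnW kN); have [h0 res] := Hk k kN.
have [cS S0 S1 SV Seq] := resolvent_step h0 ck res.
rewrite k0 in S0 Seq; rewrite k1 in S1 Seq; rewrite S0 S1 in SV; split=> //.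
have [Hm|HV] := Hv.
  by left; apply: grid_variation_le_eq (Hm) => x hx; rewrite Seq.
have [|h] := SV _ HV; last by left.
rewrite (_ : V - 4 * tau k - 4 * _ = V - 4 * tau k.+1); first by right.
by ring.
Qed.

Lemma euler_chain_stationary (R : realType) (u0 : R -> R) (N : nat) (tau : nat -> R)
    (v : nat -> R -> R) (V : R) (k : nat) :
  unif_continuous01 u0 -> grid_variation_le u0 V -> euler_chain u0 N tau v ->
  grid_variation_le (v k) `|u0 1 - u0 0| ->
  forall j, (k <= j)%N -> (j <= N)%N -> {in `[0, 1], v j =1 v k}.
Proof.
move=> cu uV ch Hm; elim=> [|j IH]; first by rewrite leqn0 => /eqP ->.
rewrite leq_eqVlt => /orP[/eqP -> //|kj] jN x hx.
have {}IH := IH kj (ltnW jN).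
have [cj j0 j1 _] := euler_chain_variation cu uV ch (ltnW jN).
have [_ _ /(_ j jN)[h0 res]] := ch.
have [_ _ _ _ Seq] := resolvent_step h0 cj res.
rewrite j0 j1 in Seq; rewrite Seq//; first exact: IH.
by apply: grid_variation_le_eq Hm => y hy; rewrite IH.
Qed.

Lemma mesh_cell (R : realType) (N : nat) (tau : nat -> R) (t : R) :
  tau 0%N < t -> t <= tau N -> exists2 k, (k < N)%N & tau k < t <= tau k.+1.
Proof.
move=> t0 tN; have ex : exists k, t <= tau k by exists N.
case: (ex_minnP ex) => -[|k] tk mk; first by rewrite leNgt t0 in tk.
exists k; first exact: mk.
by rewrite tk andbT ltNge; apply/negP => /mk; rewrite ltnn.
Qed.

(** For each [e], one Euler chain up to [max s t] covers both times. Both of its states there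
    already have least variation, so they coincide, and this common state is close to [u s] and to
    [u t]. *)
Lemma mild_stationary (R : realType) (u0 : R -> R) (u : R -> R -> R) (V s t : R) :
  unif_continuous01 u0 -> grid_variation_le u0 V -> mild_solution u0 u ->
  (forall r, 0 <= r -> unif_continuous01 (u r)) ->
  0 < s -> 0 < t -> (V - `|u0 1 - u0 0|) / 4 < s -> (V - `|u0 1 - u0 0|) / 4 < t ->
  {in `[0, 1], u s =1 u t}.
Proof.
move=> cu uV [_ _ mild] cr s0 t0 sV tV.
apply: L2_close_eq; [exact/cr/ltW|exact/cr/ltW|move=> e e0].
have T0 : 0 < Num.max s t by rewrite lt_max s0.
have [N [tau [v [tau0 tauN v0 Hk]]]] := mild (Num.max s t) e T0 e0.
have ch : euler_chain u0 N tau v.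
  by split=> // k /Hk[/andP[h0 _] ? _].
have cell r : 0 < r -> r <= Num.max s t -> (V - `|u0 1 - u0 0|) / 4 < r ->
    exists k, [/\ (k <= N)%N, L2_close e (u r) (v k) & grid_variation_le (v k) `|u0 1 - u0 0|].
  move=> r0 rT rV; have [||k kN hk] := @mesh_cell _ N tau r; rewrite ?tau0 ?tauN//.
  exists k.+1; have [_ _ close] := Hk k kN; split=> //; first by apply: close; rewrite in_itv.
  have [_ k0 k1 [//|HV]] := euler_chain_variation cu uV ch kN.
  (* As [r <= tau k.+1], the second bound would be smaller than the boundary difference, which no
     variation can be. *)
  by have := grid_variation_ge HV; rewrite k0 k1; lra.
have [j [jN js jm]] := cell s s0 ltac:(by rewrite le_max lexx) sV.
have [k [kN kt km]] := cell t t0 ltac:(by rewrite le_max lexx orbT) tV.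
have [cj _ _ _] := euler_chain_variation cu uV ch jN.
exists (v j); split=> //; apply: L2_close_eqr kt => x hx.
have [jk|/ltnW kj] := leqP j k.
  exact: (euler_chain_stationary cu uV ch jm jk kN).
by rewrite (euler_chain_stationary cu uV ch km kj jN).
Qed.

(** Serves the case without essential facets, where the comparison must reach back to time 0. *)
Lemma mild_constant (R : realType) (u0 : R -> R) (u : R -> R -> R) (t : R) :
  unif_continuous01 u0 -> grid_variation_le u0 `|u0 1 - u0 0| -> mild_solution u0 u ->
  unif_continuous01 (u t) -> 0 < t -> {in `[0, 1], u t =1 u0}.
Proof.
move=> cu um [_ _ mild] ct t0; apply: L2_close_eq => // e e0.
have [N [tau [v [tau0 tauN v0 Hk]]]] := mild t e t0 e0.
have ch : euler_chain u0 N tau v.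
  by split=> // k /Hk[/andP[h0 _] ? _].
exists u0; split=> //; last exact: L2_close_refl.
have [||k kN hk] := @mesh_cell _ N tau t; rewrite ?tau0 ?tauN//.
have [_ _ close] := Hk k kN.
apply: (@L2_close_eqr _ _ _ (v k.+1)); last by apply: close; rewrite in_itv.
move=> x hx; rewrite (euler_chain_stationary cu um ch _ (leq0n k.+1))// ?v0//.
by apply: grid_variation_le_eq um => y hy; rewrite v0.
Qed.

(** * Essential facets *)

Lemma constant_on_eq (R : realType) (f g : R -> R) (p q : R) :
  {in `[0, 1], f =1 g} -> 0 <= p -> p <= q -> q <= 1 ->
  constant_on f p q -> constant_on g p q.
Proof.
move=> fg p0 pq q1 H x; rewrite in_itv/= => hx.
by rewrite -!fg ?in_itv/= ?H ?in_itv//=; lra.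
Qed.

Lemma facet_eq (R : realType) (f g : R -> R) (p q : R) :
  {in `[0, 1], f =1 g} -> facet f p q -> facet g p q.
Proof.
move=> fg [p0 pq q1 H Hm]; split=> //; first exact: constant_on_eq H.
move=> p' q' p'0 pp qq q'1 H'; apply: Hm => //.
by apply: constant_on_eq H' => //; [move=> x hx; rewrite fg|lra].
Qed.

Lemma convex_facet_eq (R : realType) (f g : R -> R) (p q : R) :
  {in `[0, 1], f =1 g} -> convex_facet f p q -> convex_facet g p q.
Proof.
move=> fg [Hf [e [e0 pe qe [H1 H2] [H3 H4]]]]; split; first exact: facet_eq Hf.
have [p0 pq q1 _ _] := Hf.
exists e; split=> //; split.
- move=> x y; rewrite !in_itv/= => hx hy xy; rewrite -!fg ?in_itv/=; try lra.
  by apply: H1; rewrite ?in_itv.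
- move=> x; rewrite in_itv/= => hx; rewrite -!fg ?in_itv/=; try lra.
  by apply: H2; rewrite in_itv.
- move=> x y; rewrite !in_itv/= => hx hy xy; rewrite -!fg ?in_itv/=; try lra.
  by apply: H3; rewrite ?in_itv.
- move=> x; rewrite in_itv/= => hx; rewrite -!fg ?in_itv/=; try lra.
  by apply: H4; rewrite in_itv.
Qed.

Lemma concave_facet_eq (R : realType) (f g : R -> R) (p q : R) :
  {in `[0, 1], f =1 g} -> concave_facet f p q -> concave_facet g p q.
Proof.
move=> fg [Hf [e [e0 pe qe [H1 H2] [H3 H4]]]]; split; first exact: facet_eq Hf.
have [p0 pq q1 _ _] := Hf.
exists e; split=> //; split.
- move=> x y; rewrite !in_itv/= => hx hy xy; rewrite -!fg ?in_itv/=; try lra.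
  by apply: H1; rewrite ?in_itv.
- move=> x; rewrite in_itv/= => hx; rewrite -!fg ?in_itv/=; try lra.
  by apply: H2; rewrite in_itv.
- move=> x y; rewrite !in_itv/= => hx hy xy; rewrite -!fg ?in_itv/=; try lra.
  by apply: H3; rewrite ?in_itv.
- move=> x; rewrite in_itv/= => hx; rewrite -!fg ?in_itv/=; try lra.
  by apply: H4; rewrite in_itv.
Qed.

(** The refined composition at time 0 belongs to [u 0], which agrees with [u0] only on [0,1]; this
    carries [K_ess] over. *)
Lemma essential_facets_eq (R : realType) (f g : R -> R) :
  {in `[0, 1], f =1 g} -> essential_facets f = essential_facets g.
Proof.
move=> fg; have gf : {in `[0, 1], g =1 f} by move=> x hx; rewrite fg.
apply/seteqP; split=> -[p q] [] /= H.
- by left; exact: convex_facet_eq H.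
- by right; exact: concave_facet_eq H.
- by left; exact: convex_facet_eq H.
- by right; exact: concave_facet_eq H.
Qed.

Lemma essential_facets_facet (R : realType) (f : R -> R) (pq : R * R) :
  essential_facets f pq -> facet f pq.1 pq.2.
Proof. by case=> -[]. Qed.

(** Two facets that overlap have an interval as union, on which [f] is constant; maximality makes
    each equal to it. *)
Lemma facet_unique (R : realType) (f : R -> R) (p q p' q' : R) :
  facet f p q -> facet f p' q' -> p' <= p <= q' -> p = p' /\ q = q'.
Proof.
move=> [p0 pq q1 H Hm] [p'0 pq' q'1 H' Hm'] /andP[pp pq''].
have C : constant_on f p' (Num.max q q').
  move=> x; rewrite in_itv/= le_max => /andP[hx1 hx2].
  have [xq|xq] := leP x q'; first by apply: H'; rewrite in_itv/= hx1.
  have xq0 : x <= q by case/orP: hx2 => //; lra.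
  rewrite H ?in_itv/=; last lra.
  by apply: H'; rewrite in_itv/= pp.
have qm : q <= Num.max q q' by rewrite le_max lexx.
have qm' : q' <= Num.max q q' by rewrite le_max lexx orbT.
have m1 : Num.max q q' <= 1 by rewrite ge_max q1.
have [E1 E2] := Hm p' _ p'0 pp qm m1 C.
have [_ E3] := Hm' p' _ p'0 (lexx _) qm' m1 C.
by split; [exact/esym|rewrite -[LHS]E2].
Qed.

(** A facet is recovered as [(inf C, sup C)] from the component [C] of its left endpoint, because
    [C] is itself the parameter set of an essential facet. *)
Lemma finite_essential_facets (R : realType) (f : R -> R) :
  J_R f -> finite_set (essential_facets f).
Proof.
case=> _ fin comp.
apply: (@sub_finite_set _ _ ((fun C : set R => (inf C, sup C)) @` components (Xi_ess f)));
  last exact: finite_image.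
move=> [p q] ess; have Ff := essential_facets_facet ess; have [p0 pq q1 _ _] := Ff.
have Xp : Xi_ess f p by exists (p, q) => //=; rewrite in_itv/= lexx.
have cC : components (Xi_ess f) (connected_component (Xi_ess f) p) by exists p.
exists (connected_component (Xi_ess f) p) => //.
have [[p' q'] ess' CE] := comp _ cC.
have Ff' := essential_facets_facet ess'; have [_ pq' _ _ _] := Ff'.
have : connected_component (Xi_ess f) p p by exact: connected_component_refl.
rewrite CE /= in_itv/= => /(facet_unique Ff Ff')[/= E1 E2].
by rewrite inf_itvcc// sup_itvcc// E1 E2.
Qed.

(** * Monotone pieces and the initial variation *)

Lemma nondecreasing_itvcc (R : realType) (f : R -> R) (c b : R) :
  unif_continuous01 f -> 0 <= c -> b <= 1 ->
  {in `]c, b[ &, {homo f : x y / x <= y}} -> {in `[c, b] &, {homo f : x y / x <= y}}.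
Proof.
move=> cf c0 b1 H x y; rewrite !in_itv/= => hx hy.
rewrite le_eqVlt => /orP[/eqP -> //|xy]; rewrite leNgt; apply/negP => fyx.
pose e := (f x - f y) / 2; have e0 : 0 < e by rewrite /e; lra.
have [d d0 Hd] := cf e e0.
(* Moving [x] and [y] towards each other by [s] lands inside the open interval, keeps their order
   and changes each value by less than half the gap. *)
pose s := Num.min (d / 2) ((y - x) / 4).
have s0 : 0 < s by rewrite /s lt_min; lra.
have s1 : s <= d / 2 by rewrite /s ge_min lexx.
have s2 : s <= (y - x) / 4 by rewrite /s ge_min lexx orbT.
have h1 := Hd x (x + s) ltac:(lra) ltac:(lra).
have h2 := Hd y (y - s) ltac:(lra) ltac:(lra).
rewrite opprD addNKr normrN gtr0_norm// in h1.
have := H (x + s) (y - s); rewrite !in_itv/= => /(_ ltac:(lra) ltac:(lra) ltac:(lra)).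
have : `|f x - f (x + s)| < e by apply: h1; lra.
have : `|f y - f (y - s)| < e by apply: h2; rewrite opprB addrC subrK gtr0_norm//; lra.
by rewrite !ltr_norml /e; lra.
Qed.

Definition monotone_on (R : realType) (f : R -> R) (a b : R) : Prop :=
  {in `[a, b] &, {homo f : x y / x <= y}} \/ {in `[a, b] &, {homo f : x y /~ x <= y}}.

Lemma homo_constant_cat (R : realType) (f : R -> R) (a c b : R) :
  {in `[a, c], forall x, f x = f c} -> {in `[c, b] &, {homo f : x y / x <= y}} ->
  a <= c -> c <= b -> {in `[a, b] &, {homo f : x y / x <= y}}.
Proof.
move=> Hc Hm ac cb x y; rewrite !in_itv/= => hx hy xy.
have [xc|cx] := leP x c; have [yc|cy] := leP y c.
- by rewrite !Hc ?in_itv/=; lra.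
- by rewrite (Hc x) ?in_itv/=; try lra; apply: Hm; rewrite ?in_itv/=; lra.
- lra.
- by apply: Hm; rewrite ?in_itv/=; lra.
Qed.

(* To the right of [a], [f] first stays on the facet through [a], if there is one,
   and the rest of the interval lies in a single component of [0,1] minus [Xi_ess]. *)
Lemma monotone_between_facets (R : realType) (f z : R -> R) (a b : R) :
  unif_continuous01 f -> is_sgn_bar f z -> 0 <= a -> a < b -> b <= 1 ->
  (forall pq, essential_facets f pq -> ~ a < pq.1 < b) -> monotone_on f a b.
Proof.
move=> cf [Hcomp _ _] a0 ab b1 no.
have [c [ac cb fc free]] : exists c, [/\ a <= c, c <= b,
    {in `[a, c], forall x, f x = f c} & forall x, c < x < b -> ~ Xi_ess f x].
  have [[[p q] ess hpq]|none] :=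
      pselect (exists2 pq, essential_facets f pq & pq.1 <= a <= pq.2).
    have Ff := essential_facets_facet ess; rewrite /= in hpq Ff.
    have [p0 pq q1 H _] := Ff.
    exists (Num.min q b); split; rewrite ?le_min ?ge_min ?lexx ?orbT//; first lra.
    - move=> x; rewrite in_itv/= le_min => hx.
      rewrite H ?in_itv/=; last lra.
      rewrite H ?in_itv/= ?ge_min ?lexx// andbT le_min; lra.
    - move=> x; rewrite gt_min => hx [[p' q'] ess' /=]; rewrite in_itv/= => hx'.
      have Ff' := essential_facets_facet ess'; rewrite /= in Ff'.
      (* A facet reaching into []c, b[] starts no later than [a], so it overlaps the facet from [p]
         to [q] and equals it, though that one ends before [x]. *)
      have pa' : p' <= a by rewrite leNgt; apply/negP => h; apply: (no _ ess') => /=; lra.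
      have E : q = q'.
        have [pp|/ltW pp] := leP p' p.
          by have [|_ ->] := facet_unique Ff Ff' _; first lra.
        by have [|_ ->] := facet_unique Ff' Ff _; first lra.
      lra.
  exists a; split; rewrite ?lexx ?ltW//.
  - by move=> x; rewrite in_itv/= => hx; congr f; lra.
  - move=> x hx [[p q] ess /=]; rewrite in_itv/= => hx'.
    apply: none; exists (p, q) => //=; have := no _ ess; rewrite /= => h.
    have : p <= a by rewrite leNgt; apply/negP => h'; apply: h; lra.
    by lra.
have [cb'|bc] := ltP c b; last first.
  have E : c = b by lra.
  by left => x y; rewrite !in_itv/= => hx hy _; rewrite !fc// in_itv/= E.
pose m := (c + b) / 2; pose A := `[0, 1]%classic `\` Xi_ess f.
have Am : A m by split; [rewrite /= in_itv/= /m; lra|apply: free; rewrite /m; lra].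
have sub : `]c, b[%classic `<=` connected_component A m.
  apply: connected_component_max.
  - by rewrite /= in_itv/= /m; lra.
  - by move=> x; rewrite /= in_itv/= => hx; split; [rewrite /= in_itv/=; lra|exact: free].
  - by apply/connected_intervalP; exact: interval_is_interval.
have inC x : x \in `]c, b[ -> x \in connected_component A m.
  by move=> hx; rewrite inE; exact: sub.
have cA : components A (connected_component A m) by exists m.
have [[mono _]|[mono _]] := Hcomp _ cA.
  left; apply: (homo_constant_cat fc) => //; apply: nondecreasing_itvcc => //; first lra.
  by move=> x y /inC hx /inC hy; exact: mono.
right => x y hx hy xy; rewrite -lerN2.
have fcN : {in `[a, c], forall x, (\- f) x = (\- f) c} by move=> w hw /=; rewrite fc.
apply: (homo_constant_cat fcN _ ac cb) hy hx xy.
apply: nondecreasing_itvcc => //; [exact: unif_continuous01N|lra|].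
by move=> v w /inC hv /inC hw vw /=; rewrite lerN2; exact: mono.
Qed.

Lemma total_variation_monotone (R : realType) (f : R -> R) (a b : R) :
  a <= b -> monotone_on f a b -> total_variation a b f = `|f b - f a|%:E.
Proof.
move=> ab; have ha : a \in `[a, b] by rewrite in_itv/= lexx.
have hb : b \in `[a, b] by rewrite in_itv/= lexx ab.
case=> H.
  by rewrite nondecreasing_total_variation// ger0_norm// subr_ge0 H.
have H' : {in `[a, b] &, {homo (\- f) : x y / x <= y}}.
  by move=> x y hx hy xy /=; rewrite lerN2 H.
rewrite -total_variationN nondecreasing_total_variation//=.
by rewrite -opprD ler0_norm// subr_le0 H.
Qed.

Lemma count_itv_split (R : realType) (F : seq R) (a p b : R) :
  a < p < b -> (count (fun x => (a < x < p)%R) F + count (fun x => (p < x < b)%R) F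
    + count (pred1 p) F <= count (fun x => (a < x < b)%R) F)%N.
Proof.
move=> /andP[ap pb]; elim: F => //= x F IH.
suff : ((a < x < p)%R + (p < x < b)%R + (x == p) <= (a < x < b)%R)%N by lia.
have [xp|px|->] := ltgtP x p; rewrite ?andbT ?andbF ?add0n ?addn0 ?ap ?pb//.
- by case: (a < x) => //=; rewrite (lt_trans xp pb).
- by case: (x < b) => //=; rewrite (lt_trans ap px).
Qed.

(** Induction on the number of cut points inside the interval. Cutting at [p] removes [p] from both
    halves, so their numbers of pieces add up to at most that of the whole. *)
Lemma total_variation_piecewise_monotone (R : realType) (f : R -> R) (F : seq R) (W : R) :
  (forall x y, 0 <= x <= 1 -> 0 <= y <= 1 -> `|f x - f y| <= W) ->
  (forall a b, 0 <= a -> a < b -> b <= 1 -> (forall p, p \in F -> ~ a < p < b) ->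
     monotone_on f a b) ->
  forall a b, 0 <= a -> a < b -> b <= 1 ->
    (total_variation a b f <= ((count (fun x => (a < x < b)%R) F).+1%:R * W)%:E)%E.
Proof.
move=> fW mono a b.
have [n] := ubnP (count (fun x => a < x < b) F); elim: n a b => // n IH a b.
rewrite ltnS => cn a0 ab b1.
have W0 : 0 <= W by apply: le_trans (fW 0 0 _ _); rewrite ?lexx ?ler01.
have [/hasP[p pF hp]|/hasPn no] := boolP (has (fun x => a < x < b) F); last first.
  rewrite total_variation_monotone ?(ltW ab)//; last first.
    by apply: mono => // p /no /negP.
  rewrite lee_fin; apply: le_trans (fW _ _ _ _) _; try lra.
  by rewrite ler_peMl// ler1n.
have := count_itv_split F hp.
have c1 : (0 < count (pred1 p) F)%N by rewrite -has_count has_pred1.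
have arith (i j k l m : nat) : (i + j + k <= l -> 0 < k -> l <= m ->
    [/\ i < m, j < m & i.+1 + j.+1 <= l.+1])%N by move=> *; split; lia.
move=> /arith/(_ c1 cn)[h1 h2 h3]; case/andP: hp => ap pb.
rewrite (total_variationD f (ltW ap) (ltW pb)).
apply: le_trans (leeD (IH a p h1 a0 ap _) (IH p b h2 _ pb b1)) _; [lra|lra|].
by rewrite -EFinD lee_fin -mulrDl ler_wpM2r// -natrD ler_nat.
Qed.

Lemma grid_variation_le_total (R : realType) (f : R -> R) (n : nat) :
  (0 < n)%N -> ((grid_variation f n)%:E <= total_variation 0 1 f)%E.
Proof.
move=> n0; have n0R : 0 < n%:R :> R by rewrite ltr0n.
have H i : (i <= n)%N ->
    ((\sum_(0 <= j < i) `|f (j.+1%:R / n%:R) - f (j%:R / n%:R)|)%:E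
      <= total_variation 0 (i%:R / n%:R) f)%E.
  elim: i => [_|i IH iN].
    by rewrite big_geq// mul0r total_variationxx.
  have le1 : i%:R / n%:R <= i.+1%:R / n%:R :> R.
    by rewrite ler_pM2r ?invr_gt0// ler_nat.
  rewrite big_nat_recr//= EFinD (total_variationD f (divr_ge0 _ _) le1)//.
  by apply: leeD; [exact/IH/ltnW|exact: total_variation_ge].
by have := H n (leqnn n); rewrite divff ?gt_eqF.
Qed.

(** [max f - min f] is the sum of [Delta_M], [B - b] and [Delta_m], each at most the amplitude. *)
Lemma amplitude_ge (R : realType) (a_b a_e : R) (f : R -> R) (x y : R) :
  unif_continuous01 f -> 0 <= x <= 1 -> 0 <= y <= 1 ->
  `|f x - f y| <= 3 * amplitude a_b a_e f.
Proof.
move=> /unif_continuous01_within cf hx hy.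
have [M hM HM] := EVT_max ler01 cf; have [m hm Hm] := EVT_min ler01 cf.
have up w : 0 <= w <= 1 -> f w <= max01 f.
  move=> hw; apply: ub_le_sup; last by exists w => //=; rewrite in_itv.
  by exists (f M) => _ [v /= hv <-]; exact: HM.
have lo w : 0 <= w <= 1 -> min01 f <= f w.
  move=> hw; apply: ge_inf; last by exists w => //=; rewrite in_itv.
  by exists (f m) => _ [v /= hv <-]; exact: Hm.
have := up x hx; have := up y hy; have := lo x hx; have := lo y hy.
rewrite /amplitude; set B := Num.max a_b a_e; set b := Num.min a_b a_e.
set D1 := max01 f - B; set D2 := b - min01 f.
set A := Num.max _ _.
have : D1 <= A by rewrite /A le_max lexx.
have : D2 <= A by rewrite /A !le_max lexx orbT.
have : B - b <= A by rewrite /A !le_max lexx !orbT.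
by rewrite /D1 /D2 ler_norml; lra.
Qed.

Lemma monotone_off_facets (R : realType) (f z : R -> R) (a b : R) :
  unif_continuous01 f -> J_R f -> is_sgn_bar f z -> 0 <= a -> a < b -> b <= 1 ->
  (forall p, p \in [seq pq.1 | pq <- fset_set (essential_facets f)] -> ~ a < p < b) ->
  monotone_on f a b.
Proof.
move=> cf Jf fz a0 ab b1 no; apply: (monotone_between_facets cf fz a0 ab b1).
move=> pq ess; apply: no; apply: map_f.
by rewrite in_fset_set ?inE//; exact: finite_essential_facets.
Qed.

(** Only left endpoints of facets serve as cuts, since a facet is absorbed by the piece on its
    right; [K_ess] cuts give [K_ess + 1] pieces. *)
Lemma grid_variation_le_K_ess (R : realType) (f z : R -> R) (W : R) :
  unif_continuous01 f -> J_R f -> is_sgn_bar f z ->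
  (forall x y, 0 <= x <= 1 -> 0 <= y <= 1 -> `|f x - f y| <= W) ->
  grid_variation_le f ((K_ess f).+1%:R * W).
Proof.
move=> cf Jf fz fW e e0; near=> n.
have n0 : (0 < n)%N by near: n; exact: nbhs_infty_gt.
rewrite -lee_fin; apply: le_trans (grid_variation_le_total f n0) _.
apply: le_trans (total_variation_piecewise_monotone fW _ (lexx 0) ltr01 (lexx 1)) _.
  by move=> a b; exact: (monotone_off_facets cf Jf fz).
have W0 : 0 <= W by apply: le_trans (fW 0 0 _ _); rewrite ?lexx ?ler01.
rewrite lee_fin (le_trans (_ : _ <= (K_ess f).+1%:R * W)) ?lerDl ?(ltW e0)//.
rewrite ler_wpM2r// ler_nat ltnS; apply: leq_trans (count_size _ _) _.
by rewrite size_map.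
Unshelve. all: by end_near. Qed.

(** Here the claimed time bound is 0, so the crude oscillation bound does not do; the single
    monotone piece [0,1] has exactly the least variation. *)
Lemma grid_variation_le_K_ess0 (R : realType) (f z : R -> R) :
  unif_continuous01 f -> J_R f -> is_sgn_bar f z -> K_ess f = 0%N ->
  grid_variation_le f `|f 1 - f 0|.
Proof.
move=> cf Jf fz K0; have [||] := monotone_off_facets cf Jf fz (lexx 0) ltr01 (lexx 1).
- by move=> p; rewrite (size0nil K0).
- exact: grid_variation_nondecreasing.
- exact: grid_variation_nonincreasing.
Qed.

(** Next to an essential facet [f] differs strictly from its value on the facet, so its oscillation
    is positive. *)
Lemma amplitude_gt0 (R : realType) (a_b a_e : R) (f : R -> R) :
  unif_continuous01 f -> J_R f -> (0 < K_ess f)%N -> 0 < amplitude a_b a_e f.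
Proof.
move=> cf Jf; rewrite /K_ess cardfs_gt0 => /fset0Pn[[p q]].
rewrite in_fset_set; last exact: finite_essential_facets.
rewrite inE /essential_facets/= => -[] [[p0 pq q1 _ _] [e [e0 pe qe [_ H] _]]].
- have := H (p - e / 2); rewrite in_itv/= => /(_ ltac:(lra)) lt.
  have := @amplitude_ge _ a_b a_e f (p - e / 2) p cf ltac:(lra) ltac:(lra).
  by rewrite gtr0_norm ?subr_gt0//; lra.
- have := H (p - e / 2); rewrite in_itv/= => /(_ ltac:(lra)) lt.
  have := @amplitude_ge _ a_b a_e f p (p - e / 2) cf ltac:(lra) ltac:(lra).
  by rewrite gtr0_norm ?subr_gt0//; lra.
Qed.

Theorem theorem2p3 (R : realType) (a_b a_e : R) (u0 : R -> R) (u : R -> R -> R)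
    (hu0 : AF a_b a_e u0)
    (hmild : mild_solution u0 u)
    (hac : almost_classical_solution a_b a_e u0 u) :
  let ell : R := 1 in
  exists t_ext : R,
    [/\ 0 <= t_ext,
        ((0 < K_ess u0)%N -> 0 < t_ext),
        (forall t : R, t_ext < t -> {in `[0, 1], u t =1 u t_ext}) &
        t_ext <= 2 * (K_ess u0)%:R * amplitude a_b a_e u0 / ell].
Proof.
move=> ell; set A := amplitude _ _ _.
have [/abs_continuous01_unif cu0 Ju0 _ _] := hu0.
have [u00 uAF [z [uz _]]] := hac.
have cu t : 0 <= t -> unif_continuous01 (u t).
  by move=> /uAF[/abs_continuous01_unif].
have [_ J0 _ _] := uAF 0 (lexx 0).
have KE : K_ess (u 0) = K_ess u0 by rewrite /K_ess (essential_facets_eq u00).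
have [K0|Kgt] := posnP (K_ess u0).
  exists 0; split; rewrite ?K0 ?mulr0 ?mul0r//.
  move=> t t0 x hx; rewrite u00//.
  apply: (mild_constant cu0 _ hmild (cu _ (ltW t0)) t0) => //.
  have := grid_variation_le_K_ess0 (cu 0 (lexx 0)) J0 (uz 0 (lexx 0)).
  rewrite KE !u00 ?in_itv/= ?lexx ?ler01// => /(_ K0).
  exact: grid_variation_le_eq.
have A0 : 0 < A by exact: amplitude_gt0.
have K1 : 1 <= (K_ess u0)%:R :> R by rewrite ler1n.
have KA : A <= (K_ess u0)%:R * A by rewrite ler_peMl// ltW.
have V0 : grid_variation_le u0 ((K_ess u0).+1%:R * (3 * A)).
  apply: (grid_variation_le_eq u00); rewrite -KE.
  apply: (grid_variation_le_K_ess (cu 0 (lexx 0)) J0 (uz 0 (lexx 0))) => x y hx hy.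
  by rewrite !u00 ?in_itv//; exact: amplitude_ge.
(* The bound itself is the witness. It lies strictly above the threshold of [mild_stationary], as
   needed to compare later times with [t_ext] itself. *)
exists (2 * (K_ess u0)%:R * A); split=> //.
- by lra.
- by move=> _; lra.
- move=> t ht.
  have E : (K_ess u0).+1%:R * (3 * A) = 3 * ((K_ess u0)%:R * A) + 3 * A.
    by rewrite -natr1; ring.
  have m0 : 0 <= `|u0 1 - u0 0| by [].
  by apply: (mild_stationary cu0 V0 hmild cu); rewrite ?E; lra.
- by rewrite divr1.
Qed.
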